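(* Let $F$ be a field of characteristic $2$ and let $\pi$ and $\pi'$ be $2$-fold Pfister forms over $F$ such that $\pi$ and $\pi'$ are not isometric. Then there exists a field extension $E/F$ with $[E:E^2]=2$ and such that $\pi_E$ and $\pi'_E$ are anisotropic and totally separably linked but not isometric.
   Context: For $a\in F$, $[1,a]$ denotes the quadratic form $(x,y)\mapsto x^2+xy+ay^2$ on $F^2$. A $2$-fold Pfister form over $F$ is a quadratic form isometric to $\langle\langle b,a]] := [1,a]\perp b[1,a]$ with $a\in F$, $b\in F^\times$. A quadratic form $(V,q)$ is isotropic if $q(x)=0$ for some $x\ne 0$, anisotropic otherwise; it is hyperbolic if it is isometric to an orthogonal sum of copies of the hyperbolic plane $\mathbb{H}=[0,0]$, $(x,y)\mapsto xy$. $\pi_K$ denotes the scalar extension of $\pi$ to a field extension $K/F$. Two $2$-fold Pfister forms $\pi,\pi'$ over a field $E$ are totally separably linked if for every separable quadratic field extension $K/E$, $\pi_K$ is hyperbolic if and only if $\pi'_K$ is hyperbolic. $E^2=\{x^2\mid x\in E\}$.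
   Formalization: The forms π and π' are additionally assumed anisotropic over F; without this the claim is false, since an isotropic form (e.g. a hyperbolic π) stays isotropic over every extension E/F. *)

(* Defs.v *)
From HB Require Import structures.
From mathcomp Require Import all_boot all_order all_algebra all_field.

Set Implicit Arguments.
Unset Strict Implicit.
Unset Printing Implicit Defensive.

Import GRing.Theory.
Local Open Scope ring_scope.

Section QuadraticForms.
Variable F : fieldType.

Definition polar (V : vectType F) (q : V -> F) (u v : V) : F :=
  q (u + v) - q u - q v.

Definition quadratic_form (V : vectType F) (q : V -> F) : Prop :=
  (forall a v, q (a *: v) = a ^+ 2 * q v) /\
  (forall a u v w,
     polar q (a *: u + v) w = a * polar q u w + polar q v w).

Definition isometric (V W : vectType F) (q : V -> F) (r : W -> F) : Prop :=
  exists f : 'Hom(V, W), bijective f /\ forall v, r (f v) = q v.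

Definition isotropic (V : vectType F) (q : V -> F) : Prop :=
  exists2 x : V, x != 0 & q x = 0.

Definition anisotropic (V : vectType F) (q : V -> F) : Prop :=
  ~ isotropic q.

Definition orth (V W : vectType F) (q : V -> F) (r : W -> F) (x : V * W) : F :=
  q x.1 + r x.2.

Definition scale_form (V : vectType F) (b : F) (q : V -> F) (x : V) : F :=
  b * q x.

Definition orth_copies (m : nat) (V : vectType F) (q : V -> F)
    (x : {ffun 'I_m -> V}) : F :=
  \sum_i q (x i).

(* The form [a, b] on F^2. *)
Definition binary_form (a b : F) (x : (F^o * F^o)%type) : F :=
  a * x.1 ^+ 2 + x.1 * x.2 + b * x.2 ^+ 2.

Definition hyperbolic_plane := binary_form 0 0.

Definition hyperbolic (V : vectType F) (q : V -> F) : Prop :=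
  exists m : nat, isometric q (@orth_copies m _ hyperbolic_plane).

(* The form <<b, a]]. *)
Definition pfister_form (b a : F) :=
  orth (binary_form 1 a) (scale_form b (binary_form 1 a)).

Definition pfister2 (V : vectType F) (q : V -> F) : Prop :=
  quadratic_form q /\
  exists a b : F, b != 0 /\ isometric q (pfister_form b a).

End QuadraticForms.

(* MathComp has no tensor product of vector spaces, so the form q_K on         *)
(* K (x) V is written in the coordinates of the basis (1 (x) e_i)_i, where     *)
(* (e_i)_i is the chosen basis of V: the coefficients of q are mapped into K.  *)
(* For a quadratic form q, another basis gives an isometric form.              *)
Definition scalar_ext (F K : fieldType) (f : {rmorphism F -> K})
    (V : vectType F) (q : V -> F) (x : 'rV[K]_(\dim {:V})) : K :=
  let e i := (vbasis {:V})`_i in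
  \sum_(i < \dim {:V}) f (q (e i)) * x 0 i ^+ 2 +
  \sum_(i < \dim {:V}) \sum_(j < \dim {:V} | (i < j)%N)
    f (polar q (e i) (e j)) * (x 0 i * x 0 j).

Definition totally_separably_linked (E : fieldType) (V V' : vectType E)
    (q : V -> E) (q' : V' -> E) : Prop :=
  forall K : fieldExtType E, \dim {:K} = 2%N -> separable 1%AS {:K} ->
    (hyperbolic (scalar_ext (in_alg K) q) <->
     hyperbolic (scalar_ext (in_alg K) q')).

Definition is_square (E : fieldType) (x : E) : Prop := exists y, x = y ^+ 2.

(* E has a basis of n elements over its subfield k; no finiteness is built in, *)
(* whereas fieldExtType would presuppose it.                                   *)
Definition degree_over (E : fieldType) (k : E -> Prop) (n : nat) : Prop :=
  exists e : 'I_n -> E, forall x : E,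
    exists! c : {ffun 'I_n -> E}, (forall i, k (c i)) /\ x = \sum_i c i * e i.

(* Main.v *)
Require Import Defs.
From HB Require Import structures.
From mathcomp Require Import all_boot all_order all_algebra all_field.
From mathcomp Require Import ring zify.
From mathcomp Require Import boolp classical_sets filter generic_quotient.

Set Implicit Arguments.
Unset Strict Implicit.
Unset Printing Implicit Defensive.

Import GRing.Theory.
Local Open Scope ring_scope.

(* A 2-fold Pfister form <<b, a]] is the norm form of the quaternion algebra   *)
(* [a, b); call an extension faithful if it keeps all anisotropic 2-fold       *)
(* Pfister forms anisotropic. After an extension the two forms share a slot,   *)
(* <<b, a1]] and <<b, a2]], and not being isometric becomes the anisotropy of  *)
(* the third form <<b, a1 + a2]]. It remains to find a faithful extension E    *)
(* with E = E^2 + b E^2 in which, for all a, c and b <> 0, either c = w^2 + w  *)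
(* or [a, b) contains an element of trace 1 and norm c; then every separable   *)
(* quadratic extension splits both forms. One such equation is solved in the   *)
(* function field of <1, b, x>, respectively of a plane section of the quadric *)
(* [1, a + c] + b [1, a]; both are of the form k(X)(u) with u quadratic, and   *)
(* their faithfulness follows from the Cassels-Pfister theorem, by which a     *)
(* solution in rational functions gives one in polynomials. All equations over *)
(* all elements of E are solved at once by Skolemization: E consists of formal *)
(* terms, compared by an ultrafilter on the finite sets of equations.          *)

(** * Quadratic forms and the Cassels-Pfister theorem *)

(** [linkage] yields a common slot: if <1> + b[1, a] + b'[1, a'] is isotropic, both algebras contain
    trace-zero elements of the same norm; otherwise b' is changed into b over the function field of
    <1, b, b'>. By [isometric_common_slot] and [isometric_isotropic_sum], what has to survive is
    then the anisotropy of <<b, a1]], <<b, a2]] and <<b, a1 + a2]], which any faithful extension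
    preserves.

    Faithfulness starts from [quadratic_pointP]: a norm form that becomes isotropic over K(u), u^2 +
    g u + f = 0, already has over K an element of norm f and trace g. For K = F(X) and f of degree
    2, Cassels-Pfister splits this element into elements over F. In [faithful_insep] these span too
    large a totally orthogonal space; in [faithful_conic] they place a form of Arf invariant c
    inside a norm form, whose Arf invariant is trivial, although c is not of the form w^2 + w.

    Over the field E of [solvable_closure], [degree_over_squares] gives the degree. A separable
    quadratic extension is E(t) with t^2 + t = c, and both forms can be written <<e, c]], so both
    become hyperbolic ([universally_split]). Anisotropy over F is necessary, since an isotropic form
    stays isotropic over E. *)

Section QForm.
Variables (R : comNzRingType) (m : nat).
Implicit Types (A : 'M[R]_m) (x y l : 'I_m -> R).

(** In characteristic 2 a quadratic form is not determined by its polar form [bform], so A is not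
    symmetric: the matrices used below are upper triangular. *)
Definition qform A x := \sum_i \sum_j A i j * (x i * x j).
Definition bform A x y := \sum_i \sum_j A i j * (x i * y j + y i * x j).
Definition lform l x := \sum_i l i * x i.

Lemma eq_qform A x y : x =1 y -> qform A x = qform A y.
Proof. by move=> e; apply: eq_bigr => i _; apply: eq_bigr => j _; rewrite !e. Qed.

Lemma eq_lform l x y : x =1 y -> lform l x = lform l y.
Proof. by move=> e; apply: eq_bigr => i _; rewrite !e. Qed.

Lemma qform_lin A c d x y :
  qform A (fun i => c * x i + d * y i) =
  c ^+ 2 * qform A x + c * d * bform A x y + d ^+ 2 * qform A y.
Proof.
rewrite /qform /bform !mulr_sumr -!big_split; apply: eq_bigr => i _ /=.
rewrite !mulr_sumr -!big_split; apply: eq_bigr => j _ /=; ring.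
Qed.

Lemma lform_lin l c d x y :
  lform l (fun i => c * x i + d * y i) = c * lform l x + d * lform l y.
Proof.
by rewrite /lform !mulr_sumr -big_split; apply: eq_bigr => i _ /=; ring.
Qed.

Lemma qformZ A c x : qform A (fun i => c * x i) = c ^+ 2 * qform A x.
Proof.
rewrite /qform !mulr_sumr; apply: eq_bigr => i _ /=.
rewrite !mulr_sumr; apply: eq_bigr => j _ /=; ring.
Qed.

Lemma lformZ l c x : lform l (fun i => c * x i) = c * lform l x.
Proof. by rewrite /lform !mulr_sumr; apply: eq_bigr => i _ /=; ring. Qed.

End QForm.

Lemma qform_map (R S : comNzRingType) (f : {rmorphism R -> S}) m
    (A : 'M[R]_m) (x : 'I_m -> R) :
  qform (map_mx f A) (f \o x) = f (qform A x).
Proof.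
rewrite /qform rmorph_sum; apply: eq_bigr => i _ /=; rewrite rmorph_sum.
by apply: eq_bigr => j _; rewrite !mxE !rmorphM.
Qed.

Lemma lform_map (R S : comNzRingType) (f : {rmorphism R -> S}) m
    (l x : 'I_m -> R) :
  lform (f \o l) (f \o x) = f (lform l x).
Proof.
by rewrite /lform rmorph_sum; apply: eq_bigr => i _ /=; rewrite rmorphM.
Qed.

Definition qaniso (R : comNzRingType) m (A : 'M[R]_m) :=
  forall x, qform A x = 0 -> forall i, x i = 0.

Lemma coefM_top (R : comNzRingType) (p q : {poly R}) d e :
  (size p <= d.+1)%N -> (size q <= e.+1)%N -> (p * q)`_(d + e) = p`_d * q`_e.
Proof.
move=> sp sq; rewrite coefM.
have ltd : (d < (d + e).+1)%N by rewrite ltnS leq_addr.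
rewrite (bigD1 (Ordinal ltd)) //= addKn big1 ?addr0 // => i ne.
have [lt|gt|eq] := ltngtP i d.
- rewrite [q`__]nth_default ?mulr0 //; apply: leq_trans sq _.
  by rewrite -(leq_add2l i) subnKC ?addnS ?ltn_add2r // -ltnS.
- by rewrite nth_default ?mul0r //; apply: leq_trans sp _.
- by case/eqP: ne; apply: val_inj.
Qed.

Lemma tofrac_num_den (R : idomainType) (x : {fraction R}) :
  exists n d : R, d != 0 /\ FracField.tofrac d * x = FracField.tofrac n.
Proof.
elim/quotW: x => y; exists (frac y).1, (frac y).2.
split; first exact: denom_ratioP.
unlock FracField.tofrac; rewrite -[LHS]FracField.pi_mul.
apply/eqP; rewrite FracField.equivf_def /FracField.mulf /=.
by rewrite !numden_Ratio ?oner_eq0 ?mul1r ?mulr1 ?denom_ratioP // mulrC.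
Qed.

Section PolyForms.
Variables (F : fieldType) (m : nat) (A : 'M[F]_m).
Hypothesis anA : qaniso A.
Local Notation AX := (map_mx polyC A).
Local Notation K := {fraction {poly F}}.
Local Notation emb := (@FracField.tofrac {poly F} \o polyC).

Lemma coef_qform_top (P : 'I_m -> {poly F}) d :
  (forall i, (size (P i) <= d.+1)%N) ->
  (qform AX P)`_(d + d) = qform A (fun i => (P i)`_d).
Proof.
move=> sP; rewrite /qform coef_sum; apply: eq_bigr => i _.
rewrite coef_sum; apply: eq_bigr => j _.
by rewrite mxE coefCM coefM_top.
Qed.

Lemma size_qform_le (P : 'I_m -> {poly F}) d :
  (forall i, (size (P i) <= d.+1)%N) -> (size (qform AX P) <= d.*2.+1)%N.
Proof.
move=> sP; apply: leq_trans (size_sum _ _ _) _; apply/bigmax_leqP => i _.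
apply: leq_trans (size_sum _ _ _) _; apply/bigmax_leqP => j _.
rewrite mxE mul_polyC; apply: leq_trans (size_scale_leq _ _) _.
apply: leq_trans (size_polyMleq _ _) _.
by move: (size (P i)) (size (P j)) (sP i) (sP j) => *; lia.
Qed.

(** Anisotropy keeps the top coefficients from cancelling: the degree of q(P) is twice the largest
    degree of an entry. *)
Lemma qaniso_poly_size (P : 'I_m -> {poly F}) d :
  (size (qform AX P) <= d.*2.+1)%N -> forall i, (size (P i) <= d.+1)%N.
Proof.
move=> sq i; rewrite leqNgt; apply/negP => lti.
pose M := (\max_i size (P i))%N.
have ltM : (d.+1 < M)%N by apply: leq_trans lti _; apply: leq_bigmax.
have leP j : (size (P j) <= M.-1.+1)%N.
  have: (size (P j) <= M)%N by apply: leq_bigmax.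
  lia.
have tP := coef_qform_top leP; rewrite nth_default in tP; last first.
  by apply: leq_trans sq _; lia.
move/esym/anA: tP => z.
have [j eM] : {j | M = size (P j)}.
  by apply: eq_bigmax; apply/card_gt0P; exists i.
have: P j != 0 by rewrite -size_poly_gt0 -eM; lia.
by rewrite -lead_coef_eq0 /lead_coef -eM z eqxx.
Qed.

Lemma qaniso_poly : qaniso AX.
Proof.
move=> P q0 i; have := @qaniso_poly_size P 0; rewrite q0 size_poly0 => /(_ isT).
move=> s1; have eP j : P j = ((P j)`_0)%:P by apply: size1_polyC.
have: qform A (fun j => (P j)`_0) = 0.
  by rewrite -(@coef_qform_top P 0) ?q0 ?coef0.
by move/anA => z; rewrite eP z.
Qed.

Lemma common_denominator (x : 'I_m -> K) :
  exists (P : 'I_m -> {poly F}) (T : {poly F}),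
    T != 0 /\ forall i, FracField.tofrac T * x i = FracField.tofrac (P i).
Proof.
have /fin_all_exists [n nP] i := tofrac_num_den (x i).
have /fin_all_exists [d dP] := nP.
exists (fun i => (\prod_(j | j != i) d j) * n i), (\prod_j d j); split.
  by apply/prodf_neq0 => i _; case: (dP i).
move=> i; rewrite (bigD1 i) //= mulrC !rmorphM /= mulrA mulrC; congr (_ * _).
by rewrite mulrC; case: (dP i).
Qed.

Lemma qaniso_frac : qaniso (map_mx emb A).
Proof.
move=> x q0; have [P [T [T0 PT]]] := common_denominator x.
have: qform AX P = 0.
  apply/eqP; rewrite -tofrac_eq0 -qform_map -map_mx_comp.
  rewrite -(eq_qform _ PT) qformZ /=.
  by rewrite q0 mulr0.
move/qaniso_poly => P0 i; apply/eqP.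
by have /eqP := PT i; rewrite P0 rmorph0 mulf_eq0 tofrac_eq0 (negPf T0).
Qed.

Lemma size_lform_lt (l : 'I_m -> F) (r : 'I_m -> {poly F}) n :
  (0 < n)%N -> (forall i, (size (r i) < n)%N) ->
  (size (lform (polyC \o l) r) < n)%N.
Proof.
move=> n0 sr; rewrite -(prednK n0) ltnS; apply: leq_trans (size_sum _ _ _) _.
apply/bigmax_leqP => i _ /=; rewrite mul_polyC.
by apply: leq_trans (size_scale_leq _ _) _; rewrite -ltnS prednK.
Qed.

(* If P / T is a point of the affine quadric q = f, then reflecting it in the  *)
(* polynomial part s of P / T gives a point with a smaller denominator.        *)
Lemma cassels_pfister_poly (f : {poly F}) n (P : 'I_m -> {poly F})
    (T : {poly F}) :
  (size T < n)%N -> T != 0 -> qform AX P = f * T ^+ 2 ->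
  exists2 s : 'I_m -> {poly F}, qform AX s = f &
    forall (l : 'I_m -> F) (g : {poly F}), lform (polyC \o l) P = g * T ->
      lform (polyC \o l) s = g.
Proof.
elim: n P T => // n IH P T sT T0 qP.
pose s i : {poly F} := P i %/ T; pose r i : {poly F} := P i %% T.
have PE i : P i = T * s i + 1 * r i by rewrite mul1r mulrC -divp_eq.
have sr i : (size (r i) < size T)%N by rewrite ltn_modp.
(* l(r) = T (g - l(s)) has smaller degree than T, so both sides vanish: the linear conditions pass
   to s. *)
have lP l g : lform (polyC \o l) P = g * T ->
    lform (polyC \o l) s = g /\ lform (polyC \o l) r = 0.
  rewrite (eq_lform _ PE) lform_lin mul1r => e.
  have lr : lform (polyC \o l) r = T * (g - lform (polyC \o l) s).
    by rewrite mulrBr [T * g]mulrC -e addrC addKr.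
  have/(size_lform_lt l): (0 < size T)%N by rewrite size_poly_gt0.
  move=> /(_ _ sr); rewrite lr.
  have [e0|nz] := eqVneq (g - lform (polyC \o l) s) 0.
    by rewrite e0 mulr0 => _; split=> //; apply/esym/eqP; rewrite -subr_eq0 e0.
  move: (g - _) nz => x x0; rewrite size_mul //; move: T0 x0.
  by rewrite -!size_poly_gt0; move: (size T) (size x) => *; lia.
(* T' is the denominator of the reflected point. From q(r) = T T' and deg r < deg T it follows that
   deg T' < deg T. *)
pose u := qform AX s - f; pose B := bform AX s r; pose T' := - u * T - B.
have qr : qform AX r = T * T'.
  move: qP; rewrite (eq_qform _ PE) qform_lin => e.
  rewrite /T' /u /B. move: e; rewrite addrC expr1n mul1r => /(canRL (addrK _)) ->; ring.
have [r0|rn0] := boolP [forall i, r i == 0].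
  exists s => [|l g /lP[] //].
  move: qP; rewrite (@eq_qform _ _ _ P (fun i => T * s i)) => [|i]; last first.
    by rewrite PE (eqP (forallP r0 i)) mulr0 addr0.
  by rewrite qformZ mulrC => /mulIf -> //; rewrite expf_neq0.
have T'0 : T' != 0.
  apply: contraNneq rn0 => T'0; apply/forallP => i; apply/eqP.
  by apply: qaniso_poly; rewrite qr T'0 mulr0.
pose P' i := T' * s i + u * r i.
have [|//||s' qs' ls'] := IH P' T'.
- rewrite -ltnS; apply: leq_trans sT; rewrite ltnS ltnNge; apply/negP => leT.
  case/forallPn: rn0 => i; rewrite -size_poly_gt0 => ri0.
  have T2 : (1 < size T)%N by apply: leq_trans (sr i); rewrite ltnS.
  have: (size (qform AX r) <= (size T).-2.*2.+1)%N.
    by apply: size_qform_le => k; have := sr k; lia.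
  rewrite qr size_mul //; move: leT T2.
  by clear; move: (size T) (size T') => *; lia.
- by rewrite qform_lin qr -/B /T' /u; ring.
exists s' => // l g /lP[ls lr]; apply: ls'.
by rewrite lform_lin ls lr mulr0 addr0 mulrC.
Qed.


Lemma cassels_pfister (f : {poly F}) (x : 'I_m -> K) :
  qform (map_mx emb A) x = FracField.tofrac f ->
  exists2 s : 'I_m -> {poly F}, qform AX s = f &
    forall (l : 'I_m -> F) (g : {poly F}),
      lform (emb \o l) x = FracField.tofrac g -> lform (polyC \o l) s = g.
Proof.
move=> qx; have [P [T [T0 PT]]] := common_denominator x.
have qP : qform AX P = f * T ^+ 2.
  apply/eqP; rewrite -tofrac_eq -qform_map -map_mx_comp.
  by rewrite -(eq_qform _ PT) qformZ /= qx mulrC rmorphM rmorphXn.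
have [s qs ls] := cassels_pfister_poly (ltnSn _) T0 qP.
exists s => // l g lx; apply: ls; apply/eqP; rewrite -tofrac_eq -lform_map.
by rewrite -(eq_lform _ PT) lformZ /= lx mulrC rmorphM.
Qed.

(** A polynomial solution has degree at most 1 by [qaniso_poly_size]; s0 and s1 are its
    coefficients. *)
Lemma cassels_pfister_deg2 (f0 f1 f2 : F) (x : 'I_m -> K) :
  qform (map_mx emb A) x =
    emb f0 + emb f1 * FracField.tofrac 'X + emb f2 * FracField.tofrac 'X ^+ 2 ->
  exists s0 s1 : 'I_m -> F,
    [/\ qform A s0 = f0, qform A s1 = f2, bform A s0 s1 = f1 &
     forall (l : 'I_m -> F) g0 g1,
       lform (emb \o l) x = emb g0 + emb g1 * FracField.tofrac 'X ->
       lform l s0 = g0 /\ lform l s1 = g1].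
Proof.
rewrite /= -rmorphXn -!rmorphM -!rmorphD => /cassels_pfister[s qs ls].
have sz : forall i, (size (s i) <= 2)%N.
  apply: qaniso_poly_size; rewrite qs; apply/leq_sizeP => -[|[|[|j]]] // _.
  by rewrite !coefD !coefCM coefX coefXn coefC /= !mulr0 !addr0.
pose s0 i := (s i)`_0; pose s1 i := (s i)`_1.
have sE i : s i = 1 * (s0 i)%:P + 'X * (s1 i)%:P.
  apply/polyP => -[|[|k]]; rewrite mul1r mulrC coefD coefMX coefC /=.
  - by rewrite addr0.
  - by rewrite coefC add0r.
  - by rewrite nth_default ?(leq_trans (sz i)) // coefC addr0.
exists s0, s1.
have := qs; rewrite (eq_qform _ sE) qform_lin mul1r expr1n mul1r.
have bE : bform AX (polyC \o s0) (polyC \o s1) = (bform A s0 s1)%:P.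
  rewrite /bform rmorph_sum; apply: eq_bigr => i _; rewrite rmorph_sum.
  by apply: eq_bigr => j _; rewrite mxE /= rmorphM rmorphD !rmorphM.
rewrite !(qform_map polyC) bE => /polyP qE.
have := (qE 0%N, qE 1%N, qE 2%N).
rewrite !coefD ![_ * (_)%:P]mulrC !coefCM !coefX !coefXn !coefC /=.
rewrite !(mulr0, mulr1, addr0, add0r) => -[[-> ->] ->]; split=> // l g0 g1.
rewrite /= -!rmorphM -!rmorphD => /ls; rewrite (eq_lform _ sE) lform_lin mul1r.
rewrite !(lform_map polyC) => /polyP lE; have := (lE 0%N, lE 1%N).
rewrite !coefD ['X * _]mulrC !coefCM !coefX !coefC /=.
by rewrite !(mulr0, mulr1, addr0, add0r) => -[-> ->].
Qed.

End PolyForms.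

(** * Quaternion norms *)

Section Quaternions.
Variable R : comNzRingType.
Implicit Types a b : R.

Definition quat := ((R * R) * (R * R))%type.
Implicit Types x y : quat.

Definition quat_add x y : quat :=
  ((x.1.1 + y.1.1, x.1.2 + y.1.2), (x.2.1 + y.2.1, x.2.2 + y.2.2)).
Definition quat_scale c x : quat :=
  ((c * x.1.1, c * x.1.2), (c * x.2.1, c * x.2.2)).
Definition quat_zero : quat := ((0, 0), (0, 0)).

Definition qnorm b a x :=
  x.1.1 ^+ 2 + x.1.1 * x.1.2 + a * x.1.2 ^+ 2 +
  b * (x.2.1 ^+ 2 + x.2.1 * x.2.2 + a * x.2.2 ^+ 2).
Definition qpolar b a x y :=
  x.1.1 * y.1.1 *+ 2 + x.1.1 * y.1.2 + x.1.2 * y.1.1 + a * (x.1.2 * y.1.2) *+ 2 +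
  b * (x.2.1 * y.2.1 *+ 2 + x.2.1 * y.2.2 + x.2.2 * y.2.1
       + a * (x.2.2 * y.2.2) *+ 2).
Definition qtrace x := x.1.1 *+ 2 + x.1.2.

(* Multiplication in R[i]/(i^2 - i + a). *)
Definition bmul a (u v : R * R) : R * R :=
  (u.1 * v.1 - a * u.2 * v.2, u.1 * v.2 + u.2 * v.1 + u.2 * v.2).
Definition bconj (u : R * R) : R * R := (u.1 + u.2, - u.2).
(* Here j^2 = - b and j u = (bconj u) j, so that qnorm is multiplicative in    *)
(* every characteristic; in characteristic 2 this is the algebra [a, b).       *)
Definition qmul b a x y : quat :=
  let p := bmul a x.1 y.1 in let q := bmul a x.2 (bconj y.2) in
  let r := bmul a x.1 y.2 in let s := bmul a x.2 (bconj y.1) in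
  ((p.1 - b * q.1, p.2 - b * q.2), (r.1 + s.1, r.2 + s.2)).
Definition qconj x : quat := (bconj x.1, (- x.2.1, - x.2.2)).

Lemma qnormM b a x y : qnorm b a (qmul b a x y) = qnorm b a x * qnorm b a y.
Proof.
by case: x y => [[x1 x2] [x3 x4]] [[y1 y2] [y3 y4]]; rewrite /qnorm /=; ring.
Qed.

Lemma qnorm_conj b a x : qnorm b a (qconj x) = qnorm b a x.
Proof. by case: x => [[x1 x2] [x3 x4]]; rewrite /qnorm /=; ring. Qed.

Lemma qtrace_mul_conj b a x y : qtrace (qmul b a x (qconj y)) = qpolar b a x y.
Proof.
by case: x y => [[x1 x2] [x3 x4]] [[y1 y2] [y3 y4]];
  rewrite /qtrace /qpolar /=; ring.
Qed.

Lemma qmulA b a x y z :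
  qmul b a x (qmul b a y z) = qmul b a (qmul b a x y) z.
Proof.
case: x y z => [[x1 x2] [x3 x4]] [[y1 y2] [y3 y4]] [[z1 z2] [z3 z4]].
by rewrite /qmul /=; congr (_, _, (_, _)); ring.
Qed.

Lemma qnormZ b a c x : qnorm b a (quat_scale c x) = c ^+ 2 * qnorm b a x.
Proof. by rewrite /qnorm /=; ring. Qed.

Lemma qpolarZr b a c x y :
  qpolar b a x (quat_scale c y) = c * qpolar b a x y.
Proof. by rewrite /qpolar /=; ring. Qed.

Lemma qnormD b a x y : 
  qnorm b a (quat_add x y) = qnorm b a x + qpolar b a x y + qnorm b a y.
Proof. by rewrite /qnorm /qpolar /=; ring. Qed.

Lemma qtraceZ c x : qtrace (quat_scale c x) = c * qtrace x.
Proof. by rewrite /qtrace /=; ring. Qed.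

Lemma qpolar_mull b a x y z :
  qpolar b a (qmul b a x y) z = qpolar b a y (qmul b a (qconj x) z).
Proof.
case: x y z => [[x1 x2] [x3 x4]] [[y1 y2] [y3 y4]] [[z1 z2] [z3 z4]].
by rewrite /qpolar /=; ring.
Qed.

Lemma qpolar_mulr b a x y z :
  qpolar b a (qmul b a x y) z = qpolar b a x (qmul b a z (qconj y)).
Proof.
case: x y z => [[x1 x2] [x3 x4]] [[y1 y2] [y3 y4]] [[z1 z2] [z3 z4]].
by rewrite /qpolar /=; ring.
Qed.

Lemma qmul_conj b a x : qmul b a (qconj x) x = ((qnorm b a x, 0), (0, 0)).
Proof.
case: x => [[x1 x2] [x3 x4]].
by rewrite /qmul /qnorm /=; congr (_, _, (_, _)); ring.
Qed.

Definition qaniso2 b a := forall x, qnorm b a x = 0 -> x = quat_zero.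

Definition qdot x y :=
  x.1.1 * y.1.1 + x.1.2 * y.1.2 + x.2.1 * y.2.1 + x.2.2 * y.2.2.

Definition quat_vec x (i : 'I_4) := [:: x.1.1; x.1.2; x.2.1; x.2.2]`_i.
Definition vec_quat (v : 'I_4 -> R) : quat :=
  ((v ord0, v (inord 1)), (v (inord 2), v (inord 3))).
Definition qnorm_mx b a : 'M[R]_4 :=
  \matrix_(i, j) (nth [::] [:: [:: 1; 1; 0; 0]; [:: 0; a; 0; 0];
                   [:: 0; 0; b; b]; [:: 0; 0; 0; b * a]] i)`_j.

Lemma vec_quatK v : quat_vec (vec_quat v) =1 v.
Proof.
move=> i; rewrite /quat_vec /=; have := ltn_ord i.
by case: i => -[|[|[|[|//]]]] lt _ /=; congr v; apply: val_inj; rewrite /= ?inordK.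
Qed.

Lemma qform_qnorm b a x : qform (qnorm_mx b a) (quat_vec x) = qnorm b a x.
Proof.
rewrite /qform !big_ord_recl !big_ord0 !mxE /quat_vec /qnorm /=; ring.
Qed.

Lemma bform_qnorm b a x y :
  bform (qnorm_mx b a) (quat_vec x) (quat_vec y) = qpolar b a x y.
Proof.
rewrite /bform !big_ord_recl !big_ord0 !mxE /quat_vec /qpolar /=; ring.
Qed.

Lemma lform_qdot l x : lform (quat_vec l) (quat_vec x) = qdot l x.
Proof. by rewrite /lform !big_ord_recl big_ord0 /quat_vec /qdot /=; ring. Qed.

Lemma qaniso_qnorm b a : qaniso2 b a <-> qaniso (qnorm_mx b a).
Proof.
split=> an.
  move=> v; rewrite -(eq_qform _ (vec_quatK v)) qform_qnorm => /an e i.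
  rewrite -vec_quatK e /quat_vec /=; case: i => -[|[|[|[|]]]] //.
move=> x; rewrite -qform_qnorm => /an e.
case: x e => [[x1 x2] [x3 x4]] e; congr (_, _, (_, _)).
- exact: (e ord0).
- exact: (e (@Ordinal 4 1 isT)).
- exact: (e (@Ordinal 4 2 isT)).
- exact: (e (@Ordinal 4 3 isT)).
Qed.

End Quaternions.

Arguments quat_zero {R}.

Definition quat_map (R S : comNzRingType) (f : R -> S) (x : quat R) : quat S :=
  ((f x.1.1, f x.1.2), (f x.2.1, f x.2.2)).

Lemma quat_vec_map (R S : comNzRingType) (f : {rmorphism R -> S}) x :
  quat_vec (quat_map f x) =1 f \o quat_vec x.
Proof. by case=> -[|[|[|[|]]]]. Qed.

Lemma qnorm_mx_map (R S : comNzRingType) (f : {rmorphism R -> S}) b a :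
  map_mx f (qnorm_mx b a) = qnorm_mx (f b) (f a).
Proof.
apply/matrixP => i j; rewrite !mxE.
case: i j => -[|[|[|[|//]]]] ? [] [|[|[|[|//]]]] ? /=;
  by rewrite ?rmorph0 ?rmorph1 ?rmorphM.
Qed.

Lemma qnorm_map (R S : comNzRingType) (f : {rmorphism R -> S}) b a x :
  qnorm (f b) (f a) (quat_map f x) = f (qnorm b a x).
Proof. by rewrite /qnorm /= !(rmorphD, rmorphM, rmorphXn). Qed.

Definition faithful (F K : fieldType) (f : {rmorphism F -> K}) :=
  forall b a, qaniso2 b a -> qaniso2 (f b) (f a).

Section RationalFunctions.
Variable F : fieldType.
Definition ratfun : fieldType := {fraction {poly F}}.
Definition ratC : {rmorphism F -> ratfun} := @FracField.tofrac {poly F} \o polyC.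
Definition ratX : ratfun := FracField.tofrac 'X.

Lemma ratX_neq0 : ratX != 0.
Proof. by rewrite tofrac_eq0 polyX_eq0. Qed.

Lemma qnorm_cassels_pfister b a f0 f1 f2 (x : quat ratfun) :
  qaniso2 b a ->
  qnorm (ratC b) (ratC a) x = ratC f0 + ratC f1 * ratX + ratC f2 * ratX ^+ 2 ->
  exists s0 s1 : quat F,
    [/\ qnorm b a s0 = f0, qnorm b a s1 = f2, qpolar b a s0 s1 = f1 &
     forall (l : quat F) g0 g1,
       qdot (quat_map ratC l) x = ratC g0 + ratC g1 * ratX ->
       qdot l s0 = g0 /\ qdot l s1 = g1].
Proof.
move=> /qaniso_qnorm an; rewrite -qform_qnorm -qnorm_mx_map.
move=> /(cassels_pfister_deg2 an)[s0 [s1 [q0 q1 b01 l01]]].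
exists (vec_quat s0), (vec_quat s1).
have s0K := vec_quatK s0; have s1K := vec_quatK s1.
split; first by rewrite -qform_qnorm (eq_qform _ s0K).
- by rewrite -qform_qnorm (eq_qform _ s1K).
- rewrite -bform_qnorm -b01; apply: eq_bigr => i _; apply: eq_bigr => j _.
  by rewrite !s0K !s1K.
move=> l g0 g1; rewrite -lform_qdot => e.
have {}e : lform (ratC \o quat_vec l) (quat_vec x) = ratC g0 + ratC g1 * ratX.
  by rewrite -e; apply: eq_bigr => i _; rewrite quat_vec_map.
have [<- <-] := l01 _ _ _ e.
by rewrite -!lform_qdot (eq_lform _ s0K) (eq_lform _ s1K).
Qed.

End RationalFunctions.

(** * Rational and quadratic extensions *)

Section QuatPolar.
Variable R : comNzRingType.

Definition quat_one : quat R := ((1, 0), (0, 0)).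

Lemma qpolar_one b a (x : quat R) : qpolar b a quat_one x = qtrace x.
Proof. by rewrite /qpolar /qtrace /=; ring. Qed.

(** The coefficient vector of the linear form [qpolar b a r]; it lets trace and orthogonality
    conditions pass through Cassels-Pfister. *)
Definition qpolar_dual b a (r : quat R) : quat R :=
  ((r.1.1 *+ 2 + r.1.2, r.1.1 + a * r.1.2 *+ 2),
   (b * (r.2.1 *+ 2 + r.2.2), b * (r.2.1 + a * r.2.2 *+ 2))).

Lemma qpolar_dualE b a r x : qdot (qpolar_dual b a r) x = qpolar b a r x.
Proof. by rewrite /qpolar /qdot /=; ring. Qed.

End QuatPolar.

Arguments quat_one {R}.

Lemma qpolar_map (R S : comNzRingType) (f : {rmorphism R -> S}) b a x y :
  qpolar (f b) (f a) (quat_map f x) (quat_map f y) = f (qpolar b a x y).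
Proof. by rewrite /qpolar /= !(rmorphD, rmorphMn, rmorphM). Qed.

Lemma qtrace_map (R S : comNzRingType) (f : {rmorphism R -> S}) x :
  qtrace (quat_map f x) = f (qtrace x).
Proof. by rewrite /qtrace /= !(rmorphD, rmorphMn, rmorphM). Qed.

Section Faithful.
Variable F : fieldType.

Lemma qnorm_line b a f0 f1 f2 (x : quat (ratfun F)) :
  qaniso2 b a ->
  qnorm (ratC F b) (ratC F a) x =
    ratC F f0 + ratC F f1 * ratX F + ratC F f2 * ratX F ^+ 2 ->
  exists s0 s1 : quat F,
    [/\ qnorm b a s0 = f0, qnorm b a s1 = f2, qpolar b a s0 s1 = f1,
     forall (r : quat F) g0 g1,
       qpolar (ratC F b) (ratC F a) (quat_map (ratC F) r) x =
         ratC F g0 + ratC F g1 * ratX F ->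
       qpolar b a r s0 = g0 /\ qpolar b a r s1 = g1 &
     forall g0 g1, qtrace x = ratC F g0 + ratC F g1 * ratX F ->
       qtrace s0 = g0 /\ qtrace s1 = g1].
Proof.
move=> an /(qnorm_cassels_pfister an)[s0 [s1 [q0 q1 b01 l01]]].
have P : forall (r : quat F) g0 g1,
       qpolar (ratC F b) (ratC F a) (quat_map (ratC F) r) x =
         ratC F g0 + ratC F g1 * ratX F ->
       qpolar b a r s0 = g0 /\ qpolar b a r s1 = g1.
  move=> r g0 g1; rewrite -!qpolar_dualE => e; apply: l01; rewrite -e.
  congr (qdot _ _); rewrite /quat_map /qpolar_dual /=.
  by rewrite !(rmorphM, rmorphD, rmorphMn).
exists s0, s1; split=> // g0 g1 e; rewrite -!(qpolar_one b a); apply: P.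
by rewrite -e -(qpolar_one (ratC F b) (ratC F a)) /quat_map /= rmorph1 rmorph0.
Qed.

(* An interface to F(X): on towers of concrete fields of fractions, ring tries *)
(* to unfold the fractions.                                                    *)
Record rational_ext (K : fieldType) (f : {rmorphism F -> K}) (X : K) : Prop := {
  rational_ext_neq0 : X != 0;
  rational_ext_qaniso : forall m (A : 'M_m), qaniso A -> qaniso (map_mx f A);
  rational_ext_line : forall b a f0 f1 f2 (x : quat K),
    qaniso2 b a -> qnorm (f b) (f a) x = f f0 + f f1 * X + f f2 * X ^+ 2 ->
    exists s0 s1 : quat F,
      [/\ qnorm b a s0 = f0, qnorm b a s1 = f2, qpolar b a s0 s1 = f1,
       forall (r : quat F) g0 g1,
         qpolar (f b) (f a) (quat_map f r) x = f g0 + f g1 * X ->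
         qpolar b a r s0 = g0 /\ qpolar b a r s1 = g1 &
       forall g0 g1, qtrace x = f g0 + f g1 * X ->
         qtrace s0 = g0 /\ qtrace s1 = g1]
}.

Lemma rational_extP :
  exists (K : fieldType) (f : {rmorphism F -> K}) (X : K), rational_ext f X.
Proof.
exists (ratfun F), (ratC F), (ratX F); split; first exact: ratX_neq0.
  by move=> m A; apply: qaniso_frac.
exact: qnorm_line.
Qed.

Lemma faithful_rational (K : fieldType) (f : {rmorphism F -> K}) (X : K) :
  rational_ext f X -> faithful f.
Proof.
move=> [_ an _] b a /qaniso_qnorm/an anf; apply/qaniso_qnorm.
by rewrite -qnorm_mx_map.
Qed.

(** The second clause records all that is used about F(x). It holds vacuously when the polynomial
    has a root in F and L = F. *)
Definition quadratic_point (g f : F) (L : fieldType) (h : {rmorphism F -> L})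
    (x : L) :=
  x ^+ 2 + h g * x + h f = 0 /\
  forall b a, qaniso2 b a -> ~ qaniso2 (h b) (h a) ->
    exists2 s, qnorm b a s = f & qtrace s = g.

(** Write an isotropic vector as P + z Q over F. The coefficients of 1 and z give N(P) = f N(Q) and
    B(P, Q) = g N(Q), so P Q^-1 has norm f and trace g. *)
Lemma quadratic_pointP (g f : F) :
  exists (L : fieldType) (h : {rmorphism F -> L}) (x : L),
    quadratic_point g f h x.
Proof.
have [[r r0]|nr] := pselect (exists r, r ^+ 2 + g * r + f = 0).
  by exists F, idfun, r; split.
pose p : {poly F} := 'X^2 + g *: 'X + f%:P.
have sp : size p = 3.
  rewrite /p -addrA size_polyDl size_polyXn // (leq_ltn_trans (size_polyD _ _)) //.
  rewrite ltnS geq_max (leq_trans (size_scale_leq _ _)) ?size_polyX //.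
  by rewrite (leq_trans (size_polyC_leq1 _)).
have irr : irreducible_poly p.
  apply: cubic_irreducible; rewrite ?sp // => r; apply/negP => /rootP pr.
  by case: nr; exists r; rewrite -pr !hornerE.
have [L dimL [z /rootP rz gz]] := irredp_FAdjoin irr.
have [h hE] : exists h : {rmorphism F -> L}, h =1 in_alg L by exists (in_alg L).
have {rz} ez : z ^+ 2 + h g * z + h f = 0.
  rewrite -rz /p !rmorphD /= map_polyZ map_polyXn map_polyX map_polyC !hornerE.
  by rewrite !hE.
have ind (u v : F) : h u + z * h v = 0 -> u = 0 /\ v = 0.
  move=> e; have [v0|v0] := eqVneq v 0.
    by move: e; rewrite v0 rmorph0 mulr0 addr0 => /eqP; rewrite fmorph_eq0 => /eqP.
  case: nr; exists (- (u / v)); apply: (fmorph_inj h).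
  have zE : z = h (- (u / v)).
    apply: (mulIf (_ : h v != 0)); first by rewrite fmorph_eq0.
    rewrite -[RHS]rmorphM mulNr divfK // rmorphN.
    by apply/eqP; rewrite -addr_eq0 addrC e.
  by rewrite rmorph0 !(rmorphD, rmorphM, rmorphXn) -zE.
have dec (y : L) : exists uv : F * F, y = h uv.1 + z * h uv.2.
  have fr : free [:: 1; z].
    rewrite free_cons seq1_free span_seq1; apply/andP; split.
      apply/vlineP => -[k e]; have [|/eqP] := ind 1 (- k); last by rewrite oner_eq0.
      by rewrite rmorphN rmorph1 mulrN mulrC hE mulr_algl -e subrr.
    apply: contraT; rewrite negbK => /eqP z0.
    have [|_ /eqP] := ind 0 1; last by rewrite oner_eq0.
    by rewrite z0 mul0r rmorph0 addr0.
  have bas : basis_of fullv [:: 1; z].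
    by rewrite basisEfree fr subvf dimL sp.
  pose X : 2.-tuple L := [tuple 1; z].
  have : y \in <<X>>%VS by rewrite (span_basis bas) memvf.
  move=> /coord_span ->; rewrite !big_ord_recl big_ord0 addr0 /=.
  by eexists (_, _) => /=; rewrite [z * _]mulrC !hE mulr_algl.
exists L, h, z; split=> // b a an nan.
have [y y0 yn0] : exists2 y : quat L, qnorm (h b) (h a) y = 0 & y <> quat_zero.
  by move/existsNP: nan => [y /not_implyP[]]; exists y.
have [P [Q yE]] : exists P Q : quat F,
    y = quat_add (quat_map h P) (quat_scale z (quat_map h Q)).
  case: y {y0 yn0} => [[y1 y2] [y3 y4]].
  have [[p1 q1] /= ->] := dec y1; have [[p2 q2] /= ->] := dec y2.
  have [[p3 q3] /= ->] := dec y3; have [[p4 q4] /= ->] := dec y4.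
  by exists ((p1, p2), (p3, p4)), ((q1, q2), (q3, q4)).
move: y0; rewrite yE qnormD qnormZ qpolarZr !qnorm_map qpolar_map.
have -> : z ^+ 2 = - (h g * z + h f).
  by apply/eqP; rewrite -addr_eq0 addrA ez.
move=> e.
have [] := ind (qnorm b a P - f * qnorm b a Q) (qpolar b a P Q - g * qnorm b a Q).
  by rewrite -[RHS]e !(rmorphB, rmorphM); ring.
move=> /eqP; rewrite subr_eq0 => /eqP eP /eqP; rewrite subr_eq0 => /eqP eQ.
have nQ : qnorm b a Q != 0.
  apply/eqP => nQ0; move: eP; rewrite nQ0 mulr0 => /an P0.
  case: yn0; rewrite yE P0 (an _ nQ0) /quat_add /quat_scale /quat_map /=.
  by rewrite rmorph0 mulr0 addr0.
exists (quat_scale (qnorm b a Q)^-1 (qmul b a P (qconj Q))).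
  by rewrite qnormZ qnormM qnorm_conj eP; field.
by rewrite qtraceZ qtrace_mul_conj eQ mulrC mulfK.
Qed.

End Faithful.

Lemma faithful_comp (F K L : fieldType) (f : {rmorphism F -> K})
    (g : {rmorphism K -> L}) :
  faithful f -> faithful g -> faithful (g \o f).
Proof. by move=> ff fg b a /ff/fg. Qed.

(** * Function fields of totally singular forms *)

Lemma even_consts (R : comNzRingType) : (2 : R) = 0 ->
  [/\ - (2 : R) = 0, (4 : R) = 0, - (4 : R) = 0, (6 : R) = 0 & - (6 : R) = 0].
Proof.
move=> two0.
have four0 : (4 : R) = 0 by rewrite (natrM _ 2 2) two0 mul0r.
have six0 : (6 : R) = 0 by rewrite (natrM _ 3 2) two0 mulr0.
by rewrite two0 four0 six0 oppr0.
Qed.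

(* ring normalizes coefficients in Z and substitutes a hypothesis c = 0 only   *)
(* for the coefficient c itself.                                               *)
Ltac char2_ring two0 :=
  apply/eqP; rewrite -subr_eq0; apply/eqP;
  let e2 := fresh in let e4 := fresh in let e4' := fresh in
  let e6 := fresh in let e6' := fresh in
  have [e2 e4 e4' e6 e6'] := even_consts two0;
  ring: two0 e2 e4 e4' e6 e6'.

Section CharTwo.
Variable F : fieldType.
Hypothesis two0 : (2 : F) = 0.

Lemma mulr2n_eq0 (x : F) : x *+ 2 = 0.
Proof. by rewrite -mulr_natr two0 mulr0. Qed.

Lemma qaniso2_neq0 (b a : F) : qaniso2 b a -> b != 0.
Proof.
move=> an; apply/eqP => b0; have := an ((0, 0), (1, 0)).
rewrite /qnorm /= b0 => /(_ _)/(congr1 (fun x : quat F => x.2.1)) /= e.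
by have /eqP := e ltac:(ring); rewrite oner_eq0.
Qed.

Lemma qaniso2_nonsquare (b a : F) : qaniso2 b a -> forall c, b <> c ^+ 2.
Proof.
move=> an c e; have := an ((c, 0), (1, 0)).
rewrite /qnorm /= e => /(_ _)/(congr1 (fun x : quat F => x.2.1)) /= e1.
by have /eqP := e1 ltac:(char2_ring two0); rewrite oner_eq0.
Qed.

Lemma qtrace_char2 (x : quat F) : qtrace x = x.1.2.
Proof. by rewrite /qtrace mulr2n_eq0 add0r. Qed.

Definition tot_sing_aniso (b t : F) := forall x y z : F,
  x ^+ 2 + b * y ^+ 2 + t * z ^+ 2 = 0 -> y = 0 /\ z = 0.

(* If an anisotropic form became isotropic, the pure parts of the coefficients *)
(* of the point of norm t + b X^2 would, with 1, be pairwise orthogonal; a     *)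
(* totally orthogonal subspace has dimension at most 2.                        *)
Lemma faithful_insep (b t : F) (K L : fieldType) (f : {rmorphism F -> K})
    (X : K) (h : {rmorphism K -> L}) (x : L) :
  rational_ext f X -> tot_sing_aniso b t ->
  quadratic_point 0 (f t + f b * X ^+ 2) h x -> faithful (h \o f).
Proof.
move=> fX an [_ qP] e a ane; apply: contrapT => /= nan.
have [s ns trs] := qP _ _ (faithful_rational fX ane) nan.
have [|s0 [s1 [n0 n1 b01 _ tr01]]] := rational_ext_line (f0 := t) (f1 := 0) (f2 := b) fX ane (x := s).
  by rewrite ns rmorph0; ring.
have [] := tr01 0 0; first by rewrite trs rmorph0; ring.
rewrite !qtrace_char2; move: s0 s1 n0 n1 b01 {tr01}.
move=> [[x0 u0] [z w]] [[x1 u1] [z' w']] /= n0 n1 b01 y0 y1; subst u0 u1.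
(* Since the traces vanish, orthogonality of s0 and s1 says that (z, w) and (z', w') are
   proportional. *)
have par : z * w' = w * z'.
  apply: (mulfI (qaniso2_neq0 ane)); move: b01.
  by rewrite /qpolar /= !mulr2n_eq0 => /eqP; rewrite addr_eq0
    -subr_eq0 => /eqP b01; apply/eqP; rewrite -subr_eq0 -b01; apply/eqP; char2_ring two0.
(* Such a relation makes k s0 + k' s1 a scalar, whence k^2 t + k'^2 b = (k x0 + k' x1)^2, against
   the anisotropy of <1, b, t>. *)
have dep k k' : k * z = k' * z' -> k * w = k' * w' -> k = 0 /\ k' = 0.
  move=> ez ew.
  have [|-> ->] := an (k * x0 + k' * x1) k' k; last by [].
  rewrite -n0 -n1 /qnorm /=.
  have D0 : e * ((k * z) ^+ 2 - (k' * z') ^+ 2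
     + ((k * z) * (k * w) - (k' * z') * (k' * w'))
     + a * ((k * w) ^+ 2 - (k' * w') ^+ 2)) = 0 by rewrite ez ew; ring.
  by rewrite -[LHS]addr0 -[X in _ + X]D0; char2_ring two0.
have n0' : (z = 0) -> w = 0 -> False.
  by move=> z0 w0; case: (dep 1 0) => [||/eqP]; rewrite ?z0 ?w0 ?mulr0 ?mul0r ?oner_eq0.
have [z0|z0] := eqVneq z 0; last first.
  by case: (dep z' z) => [||_ /eqP]; rewrite ?(negPf z0) // 1?mulrC // mulrC -par mulrC.
have [w0|w0] := eqVneq w 0; first by apply: n0'.
by case: (dep w' w) => [||_ /eqP]; rewrite ?(negPf w0) // 1?mulrC ?par // mulrC.
Qed.

End CharTwo.

Lemma two0_map (R S : comNzRingType) (f : {rmorphism R -> S}) :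
  (2 : R) = 0 -> (2 : S) = 0.
Proof. by move=> e; rewrite -(rmorph_nat f) e rmorph0. Qed.

(** * Function fields of conics *)

Section QuatConjugation.
Variables (R : comNzRingType) (b a : R).
Implicit Types x y s t : quat R.

Lemma qconjK x : qconj (qconj x) = x.
Proof. by case: x => [[x1 x2] [x3 x4]]; rewrite /qconj /bconj /=;
  congr (_, _, (_, _)); ring. Qed.

Lemma quat_sub_eq0 x y : quat_add x (quat_scale (-1) y) = quat_zero -> y = x.
Proof.
case: x y => [[x1 x2] [x3 x4]] [[y1 y2] [y3 y4]].
rewrite /quat_add /quat_scale /= !mulN1r => -[] /eqP + /eqP + /eqP + /eqP.
by rewrite !subr_eq0 => /eqP-> /eqP-> /eqP-> /eqP->.
Qed.

Lemma qtrace_conj x : qtrace (qconj x) = qtrace x.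
Proof. by rewrite /qtrace /=; ring. Qed.

Lemma qpolarC x y : qpolar b a x y = qpolar b a y x.
Proof. by rewrite /qpolar; ring. Qed.

(* Skolem-Noether: elements of equal trace and norm are conjugate.             *)
Lemma qmul_intertwine x y :
  qtrace x = qtrace y -> qnorm b a x = qnorm b a y ->
  let t := quat_add x (quat_scale (-1) (qconj y)) in
  qmul b a x t = qmul b a t y.
Proof.
case: x y => [[x1 x2] [x3 x4]] [[y1 y2] [y3 y4]] et en.
have T0 (c d X : R) : X = X + c * (qtrace ((x1, x2), (x3, x4)) -
    qtrace ((y1, y2), (y3, y4))) + d * (qnorm b a ((y1, y2), (y3, y4)) -
    qnorm b a ((x1, x2), (x3, x4))).
  by rewrite et en !subrr !mulr0 !addr0.
rewrite /qmul /quat_add /quat_scale /=; congr (_, _, (_, _)).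
- by rewrite [RHS](T0 x1 1) /qnorm /qtrace /=; ring.
- by rewrite [RHS](T0 x2 0) /qnorm /qtrace /=; ring.
- by rewrite [RHS](T0 x3 0) /qnorm /qtrace /=; ring.
- by rewrite [RHS](T0 x4 0) /qnorm /qtrace /=; ring.
Qed.

(** For invertible t this says that conjugation by t, which takes y to z, is an isometry; the factor
    N(t) comes from replacing t^-1 by the conjugate of t. *)
Lemma qpolar_conjl t x y z :
  qmul b a z t = qmul b a t y ->
  qpolar b a (qmul b a (qmul b a t x) (qconj t)) z =
  qnorm b a t * qpolar b a x y.
Proof.
move=> e; rewrite qpolar_mulr qconjK e qpolar_mull qmulA qmul_conj.
by rewrite /qpolar /qmul /=; ring.
Qed.

End QuatConjugation.

Lemma qconj_map (R S : comNzRingType) (f : {rmorphism R -> S}) x :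
  qconj (quat_map f x) = quat_map f (qconj x).
Proof.
by rewrite /quat_map /qconj /bconj /= !(rmorphN, rmorphD).
Qed.

Section Conic.
Variables (F : fieldType) (two0 : (2 : F) = 0).

(* [1, a + c] + b [1, a], of Arf invariant c, is embedded in a form of trivial *)
(* Arf invariant.                                                              *)
Lemma arf_plane (e a1 a b c : F) (r h0 h1 : quat F) :
  e != 0 -> b != 0 ->
  qtrace r = 1 -> qnorm e a1 r = a + c ->
  qtrace h0 = 0 -> qtrace h1 = 0 ->
  qpolar e a1 r h0 = 0 -> qpolar e a1 r h1 = 0 ->
  qnorm e a1 h0 = b -> qnorm e a1 h1 = b * a -> qpolar e a1 h0 h1 = b ->
  exists w, w ^+ 2 + w = c.
Proof.
move=> e0 b0; rewrite !(qtrace_char2 two0).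
case: r h0 h1 => [[r1 u] [r3 r4]] [[p0 u0] [q0 s0]] [[p1 u1] [q1 s1]] /=.
move=> eu nr eu0 eu1; subst u u0 u1.
rewrite /qpolar /qnorm /= !(mulr2n_eq0 two0) => B0 B1 n0 n1 b01.
have {B0} p0E : p0 = e * (r3 * s0 + r4 * q0).
  by rewrite -[RHS]addr0 -B0; char2_ring two0.
have {B1} p1E : p1 = e * (r3 * s1 + r4 * q1).
  by rewrite -[RHS]addr0 -B1; char2_ring two0.
(* Orthogonality to r has determined the scalar parts p0 and p1. In the remaining coordinates (q, s)
   the norm is e[A, D], and k is the determinant of h0 and h1. *)
pose A := 1 + e * r4 ^+ 2; pose D := a1 + e * r3 ^+ 2.
pose k := q0 * s1 + q1 * s0.
have ek : e * k = b by rewrite -b01 /k; ring.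
have k0 : k != 0 by apply: contraNneq b0 => k0; rewrite -ek k0 mulr0.
have g0 : A * q0 ^+ 2 + q0 * s0 + D * s0 ^+ 2 = k.
  apply: (mulfI e0); rewrite ek -n0 p0E /A /D; char2_ring two0.
have g1 : A * q1 ^+ 2 + q1 * s1 + D * s1 ^+ 2 = k * a.
  apply: (mulfI e0); rewrite [RHS]mulrA ek -n1 p1E /A /D; char2_ring two0.
(* Comparing the Arf invariants of [A, D] and k[1, a]: the product of the values at the two vectors
   is k^2 A D + t^2 + t k. Moreover N(r) and A D differ by w^2 + w with w = r1 + e r3 r4. *)
pose t := A * q0 * q1 + q1 * s0 + D * s0 * s1.
have aE : a = A * D + (t / k) ^+ 2 + t / k.
  apply: (mulfI (expf_neq0 2 k0)).
  rewrite [RHS](_ : _ = k ^+ 2 * (A * D) + t ^+ 2 + t * k); last by field.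
  rewrite expr2 -mulrA -[X in X * (k * a)]g0 -g1 /k /t; char2_ring two0.
exists (r1 + e * r3 * r4 + t / k).
have cE : c = r1 ^+ 2 + r1 * 1 + a1 * 1 ^+ 2 +
   e * (r3 ^+ 2 + r3 * r4 + a1 * r4 ^+ 2) - a by move: nr; rewrite /qnorm /= => ->; ring.
rewrite [RHS]cE [X in _ - X]aE /A /D; move: (t / k) => w; char2_ring two0.
Qed.

(* The conic over F(z) is a plane section of the quadric [1, a + c] + b [1, a] *)
(* (whose isotropy makes [a, b) contain an element of trace 1 and norm c).     *)
Lemma faithful_conic (a b c : F) (K1 K2 L : fieldType)
    (f1 : {rmorphism F -> K1}) (z : K1) (f2 : {rmorphism K1 -> K2}) (y : K2)
    (h : {rmorphism K2 -> L}) (x : L) :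
  rational_ext f1 z -> rational_ext f2 y ->
  b != 0 -> (forall w, w ^+ 2 + w <> c) ->
  let beta := f1 b + f1 b * z + f1 (b * a) * z ^+ 2 in
  quadratic_point y (f2 beta + f2 (f1 (a + c)) * y ^+ 2) h x ->
  faithful ((h \o f2) \o f1).
Proof.
move=> f1z f2y b0 nc beta [_ qP] e a1 an; apply: contrapT => /= nan.
have an1 := faithful_rational f1z an; have an2 := faithful_rational f2y an1.
have {nan} [s ns trs] := qP _ _ an2 nan.
have [|s0 [s1 [n0 n1 b01 _ tr01]]] :=
    rational_ext_line (f0 := beta) (f1 := 0) (f2 := f1 (a + c)) f2y an1 (x := s).
  by rewrite ns rmorph0 mul0r addr0.
have {tr01} [] := tr01 0 1; first by rewrite trs rmorph0 rmorph1 mul1r add0r.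
move=> tr0 tr1.
(* The norm and trace of s1 are constant in z, so some r over F shares them. Conjugating s1 to r
   turns s0 into s0', orthogonal to r. *)
have [r [s0' [nr trr [ns0' trs0' Brs]]]] : exists (r : quat F) (s0' : quat K1),
    [/\ qnorm e a1 r = a + c, qtrace r = 1 &
     [/\ qnorm (f1 e) (f1 a1) s0' = beta, qtrace s0' = 0 &
      qpolar (f1 e) (f1 a1) (quat_map (f1) r) s0' = 0]].
  have [|r [r' [nr _ _ _ trr]]] := rational_ext_line (f0 := a + c) (f1 := 0) (f2 := 0) f1z an (x := s1).
    by rewrite n1 rmorph0 !mul0r !addr0.
  have {trr} [trr _] : qtrace r = 1 /\ qtrace r' = 0.
    by apply: trr; rewrite tr1 rmorph1 rmorph0 mul0r addr0.
  pose R1 := quat_map (f1) r.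
  pose t := quat_add R1 (quat_scale (-1) (qconj s1)).
  have nR1 : qnorm (f1 e) (f1 a1) R1 = f1 (a + c).
    by rewrite qnorm_map nr.
  have trR1 : qtrace R1 = 1 by rewrite qtrace_map trr rmorph1.
  have it : qmul (f1 e) (f1 a1) R1 t = qmul (f1 e) (f1 a1) t s1.
    by apply: qmul_intertwine; rewrite ?tr1 ?n1.
  (* If the intertwiner vanishes, s1 is the conjugate of r and is itself defined over F. *)
  have [t0|t0] := pselect (t = quat_zero).
    exists (qconj r), s0; split; rewrite ?qnorm_conj ?qtrace_conj //; split=> //.
    suff <- : s1 = quat_map (f1) (qconj r) by rewrite qpolarC.
    by rewrite -qconj_map -/R1 -[LHS]qconjK (quat_sub_eq0 t0).
  pose v := qnorm (f1 e) (f1 a1) t.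
  have v0 : v != 0 by apply/eqP => /an1.
  exists r, (quat_scale v^-1 (qmul (f1 e) (f1 a1)
     (qmul (f1 e) (f1 a1) t s0) (qconj t))).
  split=> //; split.
  - by rewrite qnormZ !qnormM qnorm_conj n0 -/v; field.
  - rewrite qtraceZ qtrace_mul_conj qpolar_mull qmul_conj.
    rewrite [qpolar _ _ _ _](_ : _ = v * qtrace s0); last first.
      by rewrite /qpolar /qtrace /= -/v; ring.
    by rewrite tr0 !mulr0.
  - by rewrite qpolarZr qpolarC (qpolar_conjl _ it) b01 !mulr0.
(* As beta has coefficients b, b, b a in z, h0 and h1 span b[1, a], orthogonal to 1 and r. *)
have [h0 [h1 [m0 m1 B01 Bl trl]]] := rational_ext_line f1z an ns0'.
have [Br0 Br1] : qpolar e a1 r h0 = 0 /\ qpolar e a1 r h1 = 0.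
  by apply: Bl; rewrite Brs rmorph0 mul0r addr0.
have [trh0 trh1] : qtrace h0 = 0 /\ qtrace h1 = 0.
  by apply: trl; rewrite trs0' rmorph0 mul0r addr0.
have [w we] := arf_plane (qaniso2_neq0 an) b0 trr nr trh0 trh1 Br0 Br1 m0 m1 B01.
exact: nc we.
Qed.

End Conic.

(** * Solving one equation *)

(** The two properties wanted of E: x lies in K^2 + b0 K^2; and, for z nonzero, x = w^2 + w or [y,
    z) contains an element of trace 1 and norm x. The alternative is a product, so that
    homomorphisms and ultrafilter limits preserve it. *)
Definition solves (K : fieldType) (b0 x y z : K) (s : nat -> K) : Prop :=
  x = s 0 ^+ 2 + b0 * s 1 ^+ 2 /\
  z * (s 2 ^+ 2 + s 2 + x) *
    (x + y + s 3 ^+ 2 + s 3 + z * (s 4 ^+ 2 + s 4 * s 5 + y * s 5 ^+ 2)) = 0.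

(** Unless x already has this form, <1, b0, x> is anisotropic, and its function field, given by u^2
    = x + b0 X^2, solves the equation. *)
Lemma solves_insep (F : fieldType) (b0 x : F) :
  (2 : F) = 0 -> (forall c, b0 <> c ^+ 2) ->
  exists (L : fieldType) (h : {rmorphism F -> L}),
    faithful h /\ exists u v, h x = u ^+ 2 + h b0 * v ^+ 2.
Proof.
move=> two0 nsq.
have [[u [v e]]|nx] := pselect (exists u v, x = u ^+ 2 + b0 * v ^+ 2).
  by exists F, idfun; split=> //; exists u, v.
have an : tot_sing_aniso b0 x.
  move=> p q r e.
  have [r0|r0] := eqVneq r 0; last first.
    case: nx; exists (p / r), (q / r).
    rewrite -[LHS]addr0 -[X in _ + X](mul0r (r ^- 2)) -e.
    rewrite [X in _ + X](_ : _ = (p / r) ^+ 2 + b0 * (q / r) ^+ 2 + x).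
      by char2_ring two0.
    by field.
  split=> //; apply/eqP; apply: contraT => q0.
  case: (nsq (p / q)); move: e; rewrite r0 expr0n mulr0 addr0 => e.
  rewrite -[LHS]addr0 -[X in _ + X](mul0r (q ^- 2)) -e.
  rewrite [X in _ + X](_ : _ = (p / q) ^+ 2 + b0); first by char2_ring two0.
  by field.
have [K [f [X fX]]] := rational_extP F.
have [L [h [r hr]]] := quadratic_pointP 0 (f x + f b0 * X ^+ 2).
exists L, (h \o f); split; first exact: faithful_insep fX an hr.
have {hr} [er _] := hr; exists r, (h X); move: er.
have two0L := two0_map (h \o f) two0.
rewrite rmorph0 mul0r addr0 !(rmorphD, rmorphM, rmorphXn) /= => er.
by rewrite -[RHS]addr0 -er; char2_ring two0L.
Qed.

Lemma solves_conic (F : fieldType) (x y z : F) :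
  (2 : F) = 0 ->
  exists (L : fieldType) (h : {rmorphism F -> L}),
    faithful h /\ exists w r s t,
    h z * (w ^+ 2 + w + h x) *
      (h x + h y + r ^+ 2 + r + h z * (s ^+ 2 + s * t + h y * t ^+ 2)) = 0.
Proof.
move=> two0.
have [->|z0] := eqVneq z 0.
  by exists F, idfun; split=> //; exists 0, 0, 0, 0; rewrite /= !mul0r.
have [[w e]|nx] := pselect (exists w, w ^+ 2 + w = x).
  exists F, idfun; split=> //; exists w, 0, 0, 0; rewrite /= e.
  by char2_ring two0.
have [K1 [f1 [Z f1Z]]] := rational_extP F.
have [K2 [f2 [Y f2Y]]] := rational_extP K1.
pose beta := f1 z + f1 z * Z + f1 (z * y) * Z ^+ 2.
have [L [h [r hr]]] :=
  quadratic_pointP Y (f2 beta + f2 (f1 (y + x)) * Y ^+ 2).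
exists L, ((h \o f2) \o f1); split.
  by apply: (faithful_conic two0 f1Z f2Y z0 _ hr) => w e; apply: nx; exists w.
have {hr} [er _] := hr.
have Y0 : h Y != 0 by rewrite fmorph_eq0 (rational_ext_neq0 f2Y).
(* The equation of the conic, divided by Y^2. *)
exists 0, (r / h Y), (h Y)^-1, (h (f2 Z) / h Y).
rewrite [X in _ * X](_ : _ = (r ^+ 2 + h Y * r +
   h (f2 beta + f2 (f1 (y + x)) * Y ^+ 2)) / h Y ^+ 2).
  by rewrite er mul0r mulr0.
rewrite /beta !(rmorphD, rmorphM, rmorphXn) /=.
move: (h (f2 (f1 x))) (h (f2 (f1 y))) (h (f2 (f1 z))) (h (f2 Z)) (h Y) Y0.
by move=> *; field.
Qed.

Lemma solvable_step (F : fieldType) (b0 x y z : F) :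
  (2 : F) = 0 -> (forall c, b0 <> c ^+ 2) ->
  exists (L : fieldType) (h : {rmorphism F -> L}),
    faithful h /\ exists s, solves (h b0) (h x) (h y) (h z) s.
Proof.
move=> two0 nsq.
have [K [f [ff [u [v ux]]]]] := solves_insep x two0 nsq.
have two0K := two0_map f two0.
have [L [h [fh [w [r [s [t e]]]]]]] := solves_conic (f x) (f y) (f z) two0K.
exists L, (h \o f); split; first exact: faithful_comp.
exists (fun i => [:: h u; h v; w; r; s; t]`_i); split=> //=.
by rewrite ux !(rmorphD, rmorphM, rmorphXn).
Qed.

(** * Solving all equations *)

Section Skolem.
Local Open Scope quotient_scope.
Variables (F : fieldType) (b0 : F).

(** [Sk i u v w] names the i-th coordinate of the solution chosen for the parameters u, v, w. *)
Inductive term :=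
  | Cst of F | Add of term & term | Opp of term | Mul of term & term
  | Inv of term | Sk of nat & term & term & term.

HB.instance Definition _ := gen_eqMixin term.
HB.instance Definition _ := gen_choiceMixin term.

Fixpoint tsize t : nat := match t with
  | Cst _ => 0
  | Add u v | Mul u v => (tsize u + tsize v).+1
  | Opp u | Inv u => (tsize u).+1
  | Sk _ u v w => (tsize u + tsize v + tsize w).+1
  end.

(** [msk] depends on terms, not on their values, so solutions can be assigned to each problem
    independently. *)
Record model := Model {
  mcar : fieldType;
  mmap : {rmorphism F -> mcar};
  msk : term * term * term -> nat -> mcar
}.

Fixpoint ev (M : model) t : mcar M := match t with
  | Cst c => mmap M c
  | Add u v => ev M u + ev M v
  | Opp u => - ev M u
  | Mul u v => ev M u * ev M v
  | Inv u => (ev M u)^-1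
  | Sk i u v w => msk M (u, v, w) i
  end.

Definition msat M (p : term * term * term) :=
  solves (mmap M b0) (ev M p.1.1) (ev M p.1.2) (ev M p.2) (msk M p).

Definition tweight (p : term * term * term) :=
  (tsize p.1.1 + tsize p.1.2 + tsize p.2)%N.

Lemma solves_map (K L : fieldType) (h : {rmorphism K -> L}) b x y z s :
  solves b x y z s -> solves (h b) (h x) (h y) (h z) (h \o s).
Proof.
by move=> [e1 e2]; split; rewrite /= -?e1 -!(rmorphD, rmorphM, rmorphXn) -?e1
  // e2 rmorph0.
Qed.

Hypothesis two0 : (2 : F) = 0.
Variable a0 : F.
Hypothesis an0 : qaniso2 b0 a0.

(* Processing the problems by increasing weight, the solution chosen for p     *)
(* changes the value of no term of size at most the weight of p.               *)
Lemma finite_model (S : seq (term * term * term)) :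
  exists2 M, faithful (mmap M) & forall p, p \in S -> msat M p.
Proof.
pose r := [rel p q | (tweight q <= tweight p)%N].
have rtr : transitive r by move=> q p s /= le1 le2; apply: leq_trans le2 le1.
suff {S} H S : sorted r S ->
    exists2 M, faithful (mmap M) & forall p, p \in S -> msat M p.
  have [|M fM MS] := H (sort r S).
    by apply: sort_sorted => p q; rewrite /= leq_total.
  by exists M => // p pS; apply: MS; rewrite mem_sort.
elim: S => [_|p S IH pS].
  by exists (Model idfun (fun _ _ => 0)).
have [M fM MS] := IH (path_sorted pS).
have nsq : forall c, mmap M b0 <> c ^+ 2.
  exact: (qaniso2_nonsquare (two0_map (mmap M) two0) (fM _ _ an0)).
have [L [h [fh [s sP]]]] := solvable_step (ev M p.1.1) (ev M p.1.2)
  (ev M p.2) (two0_map (mmap M) two0) nsq.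
pose M' := Model (h \o mmap M)
  (fun q => if q == p then s else h \o msk M q).
(* A Skolem term for p has size [tweight p] + 1, so it does not occur in t. *)
have evE t : (tsize t <= tweight p)%N -> ev M' t = h (ev M t).
  elim: t => //=.
  - move=> u IHu v IHv le; rewrite IHu ?IHv ?rmorphD //; lia.
  - move=> u IHu le; rewrite IHu ?rmorphN //; lia.
  - move=> u IHu v IHv le; rewrite IHu ?IHv ?rmorphM //; lia.
  - move=> u IHu le; rewrite IHu ?fmorphV //; lia.
  - move=> i u IHu v IHv w IHw le; case: eqP => // e.
    by move: le; rewrite -e /tweight /= ltnn.
have satE q : (tweight q <= tweight p)%N ->
    solves (h (mmap M b0)) (h (ev M q.1.1)) (h (ev M q.1.2)) (h (ev M q.2))
      (msk M' q) -> msat M' q.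
  by move=> le; rewrite /msat !evE //; move: le; rewrite /tweight; lia.
exists M'; first exact: faithful_comp.
move=> q; rewrite inE; have [->|nqp] := eqVneq q p.
  by move=> _; apply: satE => //=; rewrite eqxx.
move=> /= qS; apply: satE.
  by have /allP/(_ _ qS) := order_path_min rtr pS.
rewrite /= (negPf nqp); exact: solves_map (MS _ qS).
Qed.

Section Quotient.
Variables (I : Type) (U : set_system I) (UU : UltraFilter U) (M : I -> model).

Definition teq s t : bool := `[< U (fun i => ev (M i) s = ev (M i) t) >].

Lemma teq_refl : reflexive teq.
Proof. by move=> t; apply/asboolP; apply: filterS filterT. Qed.

Lemma teq_sym : symmetric teq.
Proof.
by move=> s t; apply/asboolP/asboolP; apply: filterS => i /= ->.
Qed.

Lemma teq_trans : transitive teq.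
Proof.
move=> s t u /asboolP ts /asboolP su; apply/asboolP.
by apply: filterS2 ts su => i /= ->.
Qed.

Canonical teq_equiv := EquivRel teq teq_refl teq_sym teq_trans.

(** The subfield of the ultraproduct of the models formed by the values of terms. *)
Definition tquot := {eq_quot teq_equiv}.

HB.instance Definition _ : EqQuotient _ teq_equiv tquot :=
  EqQuotient.on tquot.
HB.instance Definition _ := Choice.on tquot.

(** x is the class of the family v in the ultraproduct; identities are checked model by model. *)
Definition rep (x : tquot) (v : forall i, mcar (M i)) :=
  U (fun i => ev (M i) (repr x) = v i).

Lemma tquotP s t :
  U (fun i => ev (M i) s = ev (M i) t) <-> \pi_tquot s = \pi_tquot t.
Proof.
by split=> [?|/eqmodP/asboolP//]; apply/eqmodP/asboolP.
Qed.

Lemma rep_pi t : rep (\pi_tquot t) (fun i => ev (M i) t).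
Proof. by apply/tquotP; rewrite reprK. Qed.

Lemma rep_eq x y v w : rep x v -> rep y w -> U (fun i => v i = w i) -> x = y.
Proof.
rewrite /rep => rx ry vw; rewrite -[x]reprK -[y]reprK; apply/tquotP.
by apply: filterS2 vw (filterI rx ry) => i /= -> [] -> ->.
Qed.

Lemma eq_rep x v w : rep x v -> rep x w -> U (fun i => v i = w i).
Proof. by move=> rv rw; apply: filterS2 rv rw => i /= -> ->. Qed.

Definition tq_cst c : tquot := \pi_tquot (Cst c).
Definition tq_add (x y : tquot) : tquot := \pi_tquot (Add (repr x) (repr y)).
Definition tq_opp (x : tquot) : tquot := \pi_tquot (Opp (repr x)).
Definition tq_mul (x y : tquot) : tquot := \pi_tquot (Mul (repr x) (repr y)).
Definition tq_inv (x : tquot) : tquot := \pi_tquot (Inv (repr x)).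

Lemma rep_cst c : rep (tq_cst c) (fun i => mmap (M i) c).
Proof. exact: rep_pi. Qed.

Lemma rep_add x y v w :
  rep x v -> rep y w -> rep (tq_add x y) (fun i => v i + w i).
Proof.
rewrite /rep /tq_add => rx ry.
by apply: filterS2 (rep_pi (Add (repr x) (repr y))) (filterI rx ry) => i /= -> [] -> ->.
Qed.

Lemma rep_opp x v : rep x v -> rep (tq_opp x) (fun i => - v i).
Proof. by rewrite /rep /tq_opp => rx; apply: filterS2 (rep_pi (Opp (repr x))) rx => i /= -> ->. Qed.

Lemma rep_mul x y v w :
  rep x v -> rep y w -> rep (tq_mul x y) (fun i => v i * w i).
Proof.
rewrite /rep /tq_mul => rx ry.
by apply: filterS2 (rep_pi (Mul (repr x) (repr y))) (filterI rx ry) => i /= -> [] -> ->.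
Qed.

Lemma rep_inv x v : rep x v -> rep (tq_inv x) (fun i => (v i)^-1).
Proof. by rewrite /rep /tq_inv => rx; apply: filterS2 (rep_pi (Inv (repr x))) rx => i /= -> ->. Qed.

Lemma repr_rep x : rep x (fun i => ev (M i) (repr x)).
Proof. by rewrite /rep; apply: filterS filterT. Qed.

Ltac rep_auto := repeat first
  [exact: rep_cst | apply: rep_add | apply: rep_mul | apply: rep_opp
  | apply: rep_inv | exact: repr_rep].

Ltac rep_ring := apply: rep_eq; [rep_auto | rep_auto | apply: filterS filterT => i _ /=].

Lemma tq_addA : associative tq_add.
Proof. by move=> x y z; rep_ring; rewrite addrA. Qed.

Lemma tq_addC : commutative tq_add.
Proof. by move=> x y; rep_ring; rewrite addrC. Qed.

Lemma tq_add0 : left_id (tq_cst 0) tq_add.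
Proof. by move=> x; rep_ring; rewrite rmorph0 add0r. Qed.

Lemma tq_addN : left_inverse (tq_cst 0) tq_opp tq_add.
Proof. by move=> x; rep_ring; rewrite addNr rmorph0. Qed.

HB.instance Definition _ :=
  GRing.isZmodule.Build tquot tq_addA tq_addC tq_add0 tq_addN.

Lemma tq_mulA : associative tq_mul.
Proof. by move=> x y z; rep_ring; rewrite mulrA. Qed.

Lemma tq_mulC : commutative tq_mul.
Proof. by move=> x y; rep_ring; rewrite mulrC. Qed.

Lemma tq_mul1 : left_id (tq_cst 1) tq_mul.
Proof. by move=> x; rep_ring; rewrite rmorph1 mul1r. Qed.

Lemma tq_mulDl : left_distributive tq_mul tq_add.
Proof. by move=> x y z; rep_ring; rewrite mulrDl. Qed.

(** The maximality of U enters here, to provide inverses. *)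
Lemma rep_neq0 x v : rep x v -> x != tq_cst 0 -> U (fun i => v i != 0).
Proof.
move=> rx x0; have [v0|] := in_ultra_setVsetC (fun i => v i = 0) UU.
  case/eqP: x0; apply: rep_eq rx (rep_cst 0) _.
  by apply: filterS v0 => i /= ->; rewrite rmorph0.
by apply: filterS => i /= /eqP.
Qed.

Lemma tq_nonzero1 : tq_cst 1 != tq_cst 0.
Proof.
apply/eqP => e; have := rep_cst 1; rewrite e => r1.
have [i /= /eqP] := filter_ex (eq_rep r1 (rep_cst 0)).
by rewrite rmorph0 rmorph1 oner_eq0.
Qed.

HB.instance Definition _ := GRing.Zmodule_isComNzRing.Build tquot
  tq_mulA tq_mulC tq_mul1 tq_mulDl tq_nonzero1.

Lemma tq_mulV x : x != tq_cst 0 -> tq_mul (tq_inv x) x = tq_cst 1.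
Proof.
move=> /(rep_neq0 (repr_rep x)) x0; apply: rep_eq; [rep_auto | rep_auto |].
by apply: filterS x0 => i /= ?; rewrite mulVf ?rmorph1.
Qed.

Lemma tq_inv0 : tq_inv (tq_cst 0) = tq_cst 0.
Proof. by rep_ring; rewrite rmorph0 invr0. Qed.

HB.instance Definition _ := GRing.ComNzRing_isField.Build tquot tq_mulV tq_inv0.

Lemma tq_cst_zmod : zmod_morphism tq_cst.
Proof. by move=> c d; rep_ring; rewrite rmorphB. Qed.

Lemma tq_cst_monoid : monoid_morphism tq_cst.
Proof. by split=> // c d; rep_ring; rewrite rmorphM. Qed.

HB.instance Definition _ := GRing.isZmodMorphism.Build F tquot tq_cst tq_cst_zmod.
HB.instance Definition _ :=
  GRing.isMonoidMorphism.Build F tquot tq_cst tq_cst_monoid.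

Lemma repD x y v w : rep x v -> rep y w -> rep (x + y) (fun i => v i + w i).
Proof. exact: rep_add. Qed.

Lemma repM x y v w : rep x v -> rep y w -> rep (x * y) (fun i => v i * w i).
Proof. exact: rep_mul. Qed.

Lemma rep0 x v : rep x v -> U (fun i => v i = 0) -> x = 0.
Proof.
move=> rx v0; apply: rep_eq rx (rep_cst 0) _.
by apply: filterS v0 => i /= ->; rewrite rmorph0.
Qed.

Ltac rep_field := rewrite ?expr2; repeat first
  [exact: rep_cst | apply: repD | apply: repM | by [] | exact: repr_rep].

Lemma faithful_tq : (forall i, faithful (mmap (M i))) -> faithful tq_cst.
Proof.
move=> fM b a an x qx.
pose v i : quat (mcar (M i)) := ((ev (M i) (repr x.1.1), ev (M i) (repr x.1.2)),
  (ev (M i) (repr x.2.1), ev (M i) (repr x.2.2))).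
have rq : rep (qnorm (tq_cst b) (tq_cst a) x)
    (fun i => qnorm (mmap (M i) b) (mmap (M i) a) (v i)).
  by rewrite /qnorm; rep_field.
rewrite qx in rq; have q0 := eq_rep rq (rep_cst 0).
have {}q0 : U (fun i => v i = quat_zero).
  by apply: filterS q0 => i /=; rewrite rmorph0; apply: (fM i).
case: x @v q0 {qx rq} => [[x1 x2] [x3 x4]] v q0; congr (_, _, (_, _));
  by apply: rep0 (repr_rep _) _; apply: filterS q0 => i [].
Qed.

Lemma solves_tq x y z :
  U (fun i => msat (M i) (repr x, repr y, repr z)) ->
  exists s, solves (tq_cst b0) x y z s.
Proof.
move=> US; pose p := (repr x, repr y, repr z).
pose s n : tquot := \pi_tquot (Sk n (repr x) (repr y) (repr z)).
have rs n : rep (s n) (fun i => msk (M i) p n) by apply: rep_pi.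
exists s; split.
  apply: rep_eq (repr_rep x) _ _; first by rep_field.
  by apply: filterS US => i [].
apply: rep0; first by rep_field.
by apply: filterS US => i [].
Qed.

End Quotient.

Lemma solvable_closure :
  exists (E : fieldType) (h : {rmorphism F -> E}),
    faithful h /\ forall x y z, exists s, solves (h b0) x y z s.
Proof.
have /choice[M MP] : forall S : seq (term * term * term), exists M,
    faithful (mmap M) /\ forall p, p \in S -> msat M p.
  by move=> S; have [M fM MS] := finite_model S; exists M.
(* An ultrafilter containing, for each finite list, the set of lists that include it: every problem
   is then solved in almost all models. *)
pose B (S S' : seq (term * term * term)) := {subset S <= S'}.
have BF : ProperFilter (filter_from setT B).
  apply: filter_from_proper; last by move=> S _; exists S.
  apply: filter_from_filter; first by exists [::].
  move=> S S' _ _; exists (S ++ S') => // T sT.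
  by split=> p pS; apply: sT; rewrite mem_cat pS ?orbT.
have [U [UU BU]] := ultraFilterLemma BF.
exists (tquot UU M), (tq_cst UU M); split.
  by apply: faithful_tq => S; case: (MP S).
move=> x y z; apply: solves_tq; apply: BU.
by exists [:: (repr x, repr y, repr z)] => // S sS; apply: (MP S).2; apply: sS;
  rewrite mem_head.
Qed.

End Skolem.

(** * Isometries *)

Section Isometries.
Variable F : fieldType.

Lemma pfister_formE (b a : F) (x : quat F) : pfister_form b a x = qnorm b a x.
Proof.
by rewrite /pfister_form /orth /scale_form /binary_form /qnorm !mul1r.
Qed.

Lemma isometric_refl (V : vectType F) (q : V -> F) : isometric q q.
Proof.
exists \1%VF; split; last by move=> v; rewrite id_lfunE.
by exists id => v; rewrite id_lfunE.
Qed.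

Lemma isometric_trans (V1 V2 V3 : vectType F) (q1 : V1 -> F) (q2 : V2 -> F)
    (q3 : V3 -> F) : isometric q1 q2 -> isometric q2 q3 -> isometric q1 q3.
Proof.
move=> [f [[f' fK f'K] fq]] [g [[g' gK g'K] gq]]; exists (g \o f)%VF; split.
  exists (f' \o g') => v; rewrite comp_lfunE /= ?gK ?fK //.
  by rewrite f'K g'K.
by move=> v; rewrite comp_lfunE /= gq fq.
Qed.

Lemma isometric_sym (V1 V2 : vectType F) (q1 : V1 -> F) (q2 : V2 -> F) :
  isometric q1 q2 -> isometric q2 q1.
Proof.
move=> [f [[f' fK f'K] fq]].
have kf : lker f == 0%VS by apply/lker0P; exact: can_inj fK.
have iE v : (f^-1)%VF v = f' v by rewrite -{1}[v]f'K lker0_lfunK.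
exists (f^-1)%VF; split; last by move=> v; rewrite iE -fq f'K.
by exists f => v; rewrite iE ?f'K ?fK.
Qed.

Lemma isometric_anisotropic (V1 V2 : vectType F) (q1 : V1 -> F) (q2 : V2 -> F) :
  isometric q1 q2 -> anisotropic q1 -> anisotropic q2.
Proof.
move=> /isometric_sym[f [[f' fK _] fq]] an1 [x x0 qx]; apply: an1.
exists (f x); last by rewrite fq.
by apply: contraNneq x0 => fx0; rewrite -(fK x) fx0 -(linear0 f) fK.
Qed.

Lemma qaniso2P (b a : F) : qaniso2 b a <-> anisotropic (pfister_form b a).
Proof.
split=> [an [x /eqP x0 qx]|an x qx].
  by apply: x0; apply: an; rewrite -pfister_formE.
apply: contrapT => x0; apply: an; exists x; last by rewrite pfister_formE.
by apply/eqP.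
Qed.

Lemma isometric_qaniso2 (b a b1 a1 : F) :
  isometric (pfister_form b a) (pfister_form b1 a1) ->
  qaniso2 b a -> qaniso2 b1 a1.
Proof. by move=> i /qaniso2P/(isometric_anisotropic i)/qaniso2P. Qed.

Lemma isometric_surj (V W : vectType F) (q : V -> F) (r : W -> F)
    (phi : V -> W) :
  linear phi -> (forall w, exists v, phi v = w) ->
  \dim {:V} = \dim {:W} -> (forall v, r (phi v) = q v) -> isometric q r.
Proof.
move=> lin surj dimVW rq.
pose phi' : {linear V -> W} := HB.pack phi (GRing.isLinear.Build F V W *:%R phi lin).
pose f := linfun phi'.
have fE v : f v = phi v by rewrite lfunE.
have kf : lker f == 0%VS.
  rewrite -dimv_eq0; have := limg_ker_dim f fullv; rewrite capfv.
  have -> : (f @: fullv)%VS = fullv.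
    apply/eqP; rewrite eqEsubv subvf /=; apply/subvP => w _.
    by have [v <-] := surj w; rewrite -fE memv_img ?memvf.
  by rewrite dimVW => /eqP; rewrite -[X in _ == X]add0n eqn_add2r.
exists f; split; last by move=> v; rewrite fE.
exists (f^-1)%VF; first exact: lker0_lfunK.
by move=> w; have [v <-] := surj w; rewrite -fE lker0_lfunK.
Qed.

Lemma dim_quat : \dim {: ((F^o * F^o) * (F^o * F^o))%type} = 4.
Proof. by rewrite !dimvf. Qed.

Lemma quat_linE (k : F) (u v : ((F^o * F^o) * (F^o * F^o))%type) :
  k *: u + v = quat_add (quat_scale k u) v.
Proof. by []. Qed.

Lemma pair_linE (k : F) (u v : (F^o * F^o)%type) :
  k *: u + v = (k * u.1 + v.1, k * u.2 + v.2).
Proof. by []. Qed.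

End Isometries.

Section Presentation.
Variables (F : fieldType) (two0 : (2 : F) = 0).

Definition quat_comb (b a : F) (i j x : quat F) : quat F :=
  quat_add (quat_add (quat_scale x.1.1 quat_one) (quat_scale x.1.2 i))
           (quat_add (quat_scale x.2.1 j) (quat_scale x.2.2 (qmul b a i j))).

Lemma qnorm_comb (b a : F) (i j x : quat F) :
  qtrace i = 1 -> qtrace j = 0 -> qpolar b a i j = 0 ->
  qnorm b a (quat_comb b a i j x) = qnorm (qnorm b a j) (qnorm b a i) x.
Proof.
move=> ti tj ij.
have -> : qnorm b a (quat_comb b a i j x) =
  x.1.1 ^+ 2 + x.1.1 * x.1.2 * qtrace i + x.1.2 ^+ 2 * qnorm b a i +
  qnorm b a j * (x.2.1 ^+ 2 + x.2.1 * x.2.2 * qtrace i +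
                 qnorm b a i * x.2.2 ^+ 2) +
  (x.1.1 * x.2.1 + x.1.1 * x.2.2 * qtrace i + x.1.2 * x.2.2 * qnorm b a i)
    * qtrace j +
  (x.1.2 * x.2.1 - x.1.1 * x.2.2) * qpolar b a i j.
  case: i j x {ti tj ij} => [[i1 i2] [i3 i4]] [[j1 j2] [j3 j4]] [[x1 x2] [x3 x4]].
  by rewrite /qnorm /qtrace /qpolar /=; ring.
by rewrite ti tj ij [RHS]/qnorm; ring.
Qed.

(** In the family 1, i, j, ij the norm is <<N(j), N(i)]]. The polar form of the latter is
    nondegenerate, so the family is a basis. *)
Lemma isometric_comb (b a : F) (i j : quat F) :
  qtrace i = 1 -> qtrace j = 0 -> qpolar b a i j = 0 -> qnorm b a j != 0 ->
  isometric (pfister_form (qnorm b a j) (qnorm b a i)) (pfister_form b a).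
Proof.
move=> ti tj ij j0.
pose V : vectType F := ((F^o * F^o) * (F^o * F^o))%type.
have lin : linear (quat_comb b a i j : V -> V).
  move=> k u v; rewrite !quat_linE /quat_comb /quat_add /quat_scale /=.
  by congr (_, _, (_, _)); ring.
pose phi : {linear V -> V} :=
  HB.pack (quat_comb b a i j : V -> V) (GRing.isLinear.Build F V V *:%R _ lin).
pose f : 'End(V) := linfun phi.
have fE v : f v = quat_comb b a i j v by rewrite lfunE.
have kf : lker f == 0%VS.
  rewrite -subv0; apply/subvP => x; rewrite memv_ker memv0 fE => /eqP fx.
  have P (y : quat F) : qpolar (qnorm b a j) (qnorm b a i) x y = 0.
    have xy : quat_comb b a i j (quat_add x y) = quat_comb b a i j y.
      have := lin 1 x y; rewrite fx scaler0 add0r => <-; congr quat_comb.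
      by rewrite quat_linE /quat_scale /quat_add /= !mul1r.
    have := qnormD (qnorm b a j) (qnorm b a i) x y.
    rewrite -!(qnorm_comb _ ti tj ij) xy fx -[LHS]add0r => /addIr.
    have -> : qnorm b a quat_zero = 0 by rewrite /qnorm /=; ring.
    by rewrite add0r.
  case: x fx P => [[x1 x2] [x3 x4]] _ P; apply/eqP; congr (_, _, (_, _)).
  - by have := P ((0, 1), (0, 0)); rewrite /qpolar /= => <-; char2_ring two0.
  - by have := P ((1, 0), (0, 0)); rewrite /qpolar /= => <-; char2_ring two0.
  - apply: (mulfI j0); have := P ((0, 0), (0, 1)); rewrite /qpolar /= => e.
    by rewrite mulr0 -[RHS]e; char2_ring two0.
  - apply: (mulfI j0); have := P ((0, 0), (1, 0)); rewrite /qpolar /= => e.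
    by rewrite mulr0 -[RHS]e; char2_ring two0.
exists f; split.
  by exists (f^-1)%VF => x; rewrite ?lker0_lfunK ?lker0_lfunVK.
by move=> x; rewrite fE !pfister_formE qnorm_comb.
Qed.

(** [1, t^2 + t] is the product (x + t y)(x + (t + 1) y); the factor e is absorbed into one linear
    factor. *)
Lemma isometric_hyperbolic (e t : F) : e != 0 ->
  hyperbolic (pfister_form e (t ^+ 2 + t)).
Proof.
move=> e0; exists 2.
pose V : vectType F := ((F^o * F^o) * (F^o * F^o))%type.
pose W : vectType F := {ffun 'I_2 -> (F^o * F^o)%type}.
pose phi (x : V) : W := [ffun k : 'I_2 => if k == ord0
  then (x.1.1 + t * x.1.2, x.1.1 + (t + 1) * x.1.2)
  else (e * (x.2.1 + t * x.2.2), x.2.1 + (t + 1) * x.2.2)].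
apply: (@isometric_surj _ V W _ _ phi).
- move=> k u v; apply/ffunP => l; rewrite quat_linE /phi !ffunE.
  by case: ifP => _; rewrite pair_linE /=; congr (_, _); ring.
- move=> w; pose u := w ord0; pose v := w ord_max.
  exists ((u.1 - t * (u.2 - u.1), u.2 - u.1),
          (v.1 / e - t * (v.2 - v.1 / e), v.2 - v.1 / e)).
  apply/ffunP => k; rewrite ffunE /=; case: eqP => [->|/eqP nk].
    by rewrite -/u; case: u => u1 u2 /=; congr (_, _); ring.
  have -> : k = ord_max.
    by apply: val_inj; case: k nk => -[|[|//]] //= ? /eqP.
  by rewrite -/v; case: v => v1 v2 /=; congr (_, _); field.
- by rewrite dim_quat dimvf /dim /= card_ord.
- move=> x; rewrite pfister_formE /orth_copies !big_ord_recl big_ord0 !ffunE /=.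
  rewrite /hyperbolic_plane /binary_form /qnorm /=; char2_ring two0.
Qed.

End Presentation.

(** * Scalar extension *)

Section ScalarExtension.
Variables (F K : fieldType) (h : {rmorphism F -> K}).
Local Notation QF := ((F^o * F^o) * (F^o * F^o))%type.
Local Notation QK := ((K^o * K^o) * (K^o * K^o))%type.

Lemma qnorm_sum (b a : K) n (v : 'I_n -> QK) :
  qnorm b a (\sum_i v i) = \sum_i qnorm b a (v i) +
    \sum_(i < n) \sum_(j < n | (i < j)%N) qpolar b a (v i) (v j).
Proof.
have polD (x y z : QK) :
    qpolar b a (x + y) z = qpolar b a x z + qpolar b a y z.
  by rewrite /qpolar /=; ring.
elim: n v => [|n IH] v.
  by rewrite !big_ord0 /qnorm /=; ring.
rewrite !big_ord_recr /= -[_ + _]/(quat_add _ _) qnormD IH.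
set S1 := \sum_i qnorm _ _ _; set S2 := \sum_i \sum_(j | _) _.
rewrite [X in _ = _ + (_ + X)]big_pred0 => [|j]; last first.
  by rewrite ltnNge -ltnS ltn_ord.
have -> : \sum_(i < n) \sum_(j < n.+1 | (i < j)%N)
     qpolar b a (v (widen_ord (leqnSn n) i)) (v j) =
   S2 + qpolar b a (\sum_(i < n) v (widen_ord (leqnSn n) i)) (v ord_max).
  have -> : qpolar b a (\sum_(i < n) v (widen_ord (leqnSn n) i)) (v ord_max) =
     \sum_(i < n) qpolar b a (v (widen_ord (leqnSn n) i)) (v ord_max).
    elim/big_rec2: _ => [|i x y _ <-]; first by rewrite /qpolar /=; ring.
    by rewrite polD.
  rewrite -big_split; apply: eq_bigr => i _ /=.
  by rewrite big_mkcond big_ord_recr /= ltn_ord -big_mkcond.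
by ring.
Qed.

Lemma quat_map_lin (k : F) (u v : QF) :
  (quat_map h (k *: u + v) : QK) =
  h k *: (quat_map h u : QK) + (quat_map h v : QK).
Proof.
rewrite !quat_linE /quat_map /quat_add /quat_scale /=.
by rewrite !(rmorphD, rmorphM).
Qed.

Lemma isometric_scalar_ext (V : vectType F) (q : V -> F) (b a : F) :
  isometric q (pfister_form b a) ->
  isometric (scalar_ext h q) (pfister_form (h b) (h a)).
Proof.
move=> [g [[g' gK g'K] gq]].
pose e i := (vbasis {:V})`_i; pose p i : QK := quat_map h (g (e i)).
pose phi (x : 'rV[K]_(\dim {:V})) : QK := \sum_i x 0 i *: p i.
have lin : linear phi.
  move=> k x y; rewrite /phi scaler_sumr -big_split; apply: eq_bigr => i _ /=.
  by rewrite !mxE scalerDl scalerA.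
have phi_h v : phi (\row_i h (coord (vbasis {:V}) i v)) = quat_map h (g v).
  rewrite [in RHS](coord_vbasis (memvf v)) linear_sum /=.
  have map_sum n (w : 'I_n -> QF) :
      (quat_map h (\sum_i w i) : QK) = \sum_i (quat_map h (w i) : QK).
    elim: n w => [|n IH] w; first by rewrite !big_ord0 /quat_map /= !rmorph0.
    rewrite !big_ord_recr /= -IH -[X in quat_map h (X + _)]scale1r.
    by rewrite quat_map_lin rmorph1 scale1r.
  rewrite map_sum; apply: eq_bigr => i _; rewrite mxE linearZ /=.
  rewrite -[X in quat_map h X]addr0 quat_map_lin.
  rewrite [X in _ = _ + X](_ : _ = 0) ?addr0 //.
  by rewrite /quat_map /= !rmorph0.
apply: (isometric_surj lin).
- move=> [[y1 y2] [y3 y4]].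
  pose r u := \row_i h (coord (vbasis {:V}) i (g' u)).
  exists (y1 *: r ((1, 0), (0, 0)) + (y2 *: r ((0, 1), (0, 0)) +
     (y3 *: r ((0, 0), (1, 0)) + (y4 *: r ((0, 0), (0, 1)) + 0)))).
  rewrite !lin !phi_h !g'K; have -> : phi 0 = 0.
    by rewrite /phi big1 // => i _; rewrite mxE scale0r.
  rewrite !quat_linE /quat_add /quat_scale /quat_map /= !rmorph0 !rmorph1.
  by congr (_, _, (_, _)); ring.
- have kg : lker g == 0%VS by apply/lker0P; exact: can_inj gK.
  rewrite dim_quat -(dim_quat F) dimvf /dim /= mul1n.
  have <- : (g @: fullv)%VS = fullv.
    apply/eqP; rewrite eqEsubv subvf /=; apply/subvP => w _.
    by rewrite -(g'K w) memv_img ?memvf.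
  by rewrite limg_dim_eq // (eqP kg) capv0.
- move=> x; rewrite pfister_formE qnorm_sum /scalar_ext; congr (_ + _).
    apply: eq_bigr => i _; rewrite -[_ *: _]/(quat_scale _ _) qnormZ qnorm_map.
    by rewrite -pfister_formE gq mulrC.
  apply: eq_bigr => i _; apply: eq_bigr => j _.
  rewrite -![_ *: _]/(quat_scale _ _) qpolarZr qpolarC qpolarZr qpolarC.
  rewrite qpolar_map /polar -!gq !pfister_formE linearD.
  have cancel3 (A B C : F) : A + B + C - A - C = B by ring.
  by rewrite [qnorm b a (_ + _)]qnormD cancel3; ring.
Qed.

End ScalarExtension.

(** * Common slots *)

Section Slots.
Variables (F : fieldType) (two0 : (2 : F) = 0).

(** If both binary norms are nonzero, b is their quotient, hence b n2^2 = u1^2 + u1 u2 + e u2^2.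
    This can be solved for e, since u2 = 0 would make b a square. *)
Lemma isotropic_slot (b e : F) :
  (forall c, b <> c ^+ 2) -> ~ qaniso2 b e ->
  exists l w, e = l ^+ 2 + l + b * w ^+ 2.
Proof.
move=> nsq /existsNP[[[x1 x2] [x3 x4]] /not_implyP[]].
rewrite /qnorm /=; set n1 := x1 ^+ 2 + _ + _; set n2 := x3 ^+ 2 + _ + _ => n0 nx.
have split_e (p q : F) : p ^+ 2 + p * q + e * q ^+ 2 = 0 -> q != 0 ->
    e = (p / q) ^+ 2 + p / q + b * 0 ^+ 2.
  move=> pq q0; apply: (mulfI (expf_neq0 2 q0)).
  rewrite [RHS](_ : _ = p ^+ 2 + p * q); last by field.
  by rewrite -[RHS]addr0 -pq; char2_ring two0.
have [n20|n20] := eqVneq n2 0.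
  have n10 : n1 = 0 by move: n0; rewrite n20 mulr0 addr0.
  have [x40|x40] := eqVneq x4 0; last by exists (x3 / x4), 0; apply: split_e.
  have [x20|x20] := eqVneq x2 0; last by exists (x1 / x2), 0; apply: split_e.
  case: nx; move: n10 n20; rewrite /n1 /n2 x20 x40 !expr0n !mulr0 !addr0.
  by move=> /eqP + /eqP; rewrite !expf_eq0 => /andP[_ /eqP->] /andP[_ /eqP->].
pose u := bmul e (x1, x2) (bconj (x3, x4)).
have un : u.1 ^+ 2 + u.1 * u.2 + e * u.2 ^+ 2 = b * n2 ^+ 2.
  rewrite [LHS](_ : _ = n1 * n2); last by rewrite /u /n1 /n2 /=; ring.
  have -> : n1 = b * n2 by rewrite -[RHS]add0r -n0; char2_ring two0.
  by ring.
have [u20|u20] := eqVneq u.2 0.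
  case: (nsq (u.1 / n2)); rewrite u20 mulr0 expr0n mulr0 !addr0 in un.
  by rewrite expr_div_n un; field.
exists (u.1 / u.2), (n2 / u.2); apply: (mulfI (expf_neq0 2 u20)).
rewrite [RHS](_ : _ = u.1 ^+ 2 + u.1 * u.2 + b * n2 ^+ 2); last by field.
by rewrite -un; char2_ring two0.
Qed.

(** If a1 + a2 = l^2 + l + b w^2, then l + i + w j has trace 1 and norm a2 and is orthogonal to
    j. *)
Lemma isometric_common_slot (b a1 a2 : F) :
  qaniso2 b a1 -> ~ qaniso2 b (a1 + a2) ->
  isometric (pfister_form b a2) (pfister_form b a1).
Proof.
move=> an /isotropic_slot[|l [w e]]; first exact: (qaniso2_nonsquare two0 an).
pose i : quat F := ((l, 1), (w, 0)); pose j : quat F := ((0, 0), (1, 0)).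
have ni : qnorm b a1 i = a2.
  have -> : a2 = (a1 + a2) - a1 by ring.
  by rewrite e /qnorm /=; char2_ring two0.
have nj : qnorm b a1 j = b by rewrite /qnorm /=; ring.
rewrite -{1}nj -ni; apply: isometric_comb => //.
- by rewrite qtrace_char2.
- by rewrite qtrace_char2.
- by rewrite /qpolar /=; char2_ring two0.
- by rewrite nj (qaniso2_neq0 an).
Qed.

(** For nonscalar j the trace and the polar product with j are independent linear forms, so some i
    of trace 1 is orthogonal to j. *)
Lemma qaniso2_scaled_slot (b a : F) (j : quat F) :
  qaniso2 b a -> qtrace j = 0 -> j.2 != (0, 0) ->
  exists a1, isometric (pfister_form (qnorm b a j) a1) (pfister_form b a).
Proof.
move=> an tj j2; have b0 := qaniso2_neq0 an.
have nj : qnorm b a j != 0.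
  by apply: contraNneq j2 => /an ->.
suff [i [ti ij]] : exists i, qtrace i = 1 /\ qpolar b a i j = 0.
  by exists (qnorm b a i); apply: isometric_comb.
move: tj; rewrite qtrace_char2 //.
case: j j2 {nj} => [[x ?] [z w]] /= zw0 ->.
have [z0|z0] := eqVneq z 0; last first.
  exists ((0, 1), (0, x / (b * z))); rewrite qtrace_char2 //; split=> //.
  rewrite /qpolar /= [LHS](_ : _ = 2 * (x + b * a * (x / (b * z)) * w)).
    by rewrite two0 mul0r.
  by field; rewrite z0.
have w0 : w != 0 by apply: contraNneq zw0 => ->; rewrite z0.
exists ((0, 1), (x / (b * w), 0)); rewrite qtrace_char2 //; split=> //.
rewrite /qpolar /= z0 [LHS](_ : _ = 2 * x); first by rewrite two0 mul0r.
by field; rewrite w0.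
Qed.

Lemma qpolar_mul2 (b a : F) (u x y : quat F) :
  qpolar b a (qmul b a u x) (qmul b a u y) = qnorm b a u * qpolar b a x y.
Proof.
by rewrite qpolar_mull qmulA qmul_conj /qpolar /qmul /=; ring.
Qed.

(** Translate the isometry so that it fixes 1, then conjugate the image of j back to j. The image of
    i becomes l + i + p j, of norm a1, so a1 + a2 = l^2 + l + b p^2. *)
Lemma isometric_isotropic_sum (b a1 a2 : F) :
  qaniso2 b a2 -> isometric (pfister_form b a1) (pfister_form b a2) ->
  ~ qaniso2 b (a1 + a2).
Proof.
move=> an [f [_ fq]] an12.
have fn (x : quat F) : qnorm b a2 (f x) = qnorm b a1 x by rewrite -!pfister_formE fq.
have fp (x y : quat F) : qpolar b a2 (f x) (f y) = qpolar b a1 x y.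
  have := fn (quat_add x y).
  rewrite [f _](_ : _ = quat_add (f x) (f y)); last exact: (linearD f).
  by rewrite !qnormD !fn => /addIr/addrI.
pose u := f quat_one.
have nu : qnorm b a2 (qconj u) = 1.
  by rewrite qnorm_conj fn /qnorm /=; ring.
have uu : qmul b a2 (qconj u) u = quat_one.
  by rewrite qmul_conj -qnorm_conj nu.
pose I := qmul b a2 (qconj u) (f ((0, 1), (0, 0))).
pose J := qmul b a2 (qconj u) (f ((0, 0), (1, 0))).
have nI : qnorm b a2 I = a1 by rewrite qnormM nu fn /qnorm /=; ring.
have nJ : qnorm b a2 J = b by rewrite qnormM nu fn /qnorm /=; ring.
have tI : qtrace I = 1.
  by rewrite -(qpolar_one b a2) -uu qpolar_mul2 nu fp /qpolar /=; ring.
have tJ : qtrace J = 0.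
  by rewrite -(qpolar_one b a2) -uu qpolar_mul2 nu fp /qpolar /=; ring.
have IJ : qpolar b a2 I J = 0.
  by rewrite qpolar_mul2 nu fp /qpolar /=; ring.
clearbody I J; pose j : quat F := ((0, 0), (1, 0)).
have nj : qnorm b a2 j = b by rewrite /qnorm /=; ring.
have tj : qtrace j = 0 by rewrite /qtrace /=; ring.
suff [I' [nI' tI' I'j]] : exists I' : quat F,
    [/\ qnorm b a2 I' = a1, qtrace I' = 1 & qpolar b a2 I' j = 0].
  move: tI' nI' I'j; rewrite qtrace_char2 //.
  case: I' => [[l ?] [p q]] /= ->; rewrite /qpolar /qnorm /= => e1 e2.
  have q0 : q = 0.
    apply: (mulfI (qaniso2_neq0 an)); rewrite mulr0 -[RHS]e2; char2_ring two0.
  have n0 : qnorm b (a1 + a2) ((l, 1), (p, 0)) = 0.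
    by rewrite /qnorm /= -e1 q0; char2_ring two0.
  have /(congr1 (fun x : quat F => x.1.2)) /= /eqP := an12 _ n0.
  by rewrite oner_eq0.
have it : qmul b a2 j (quat_add j (quat_scale (-1) (qconj J))) =
    qmul b a2 (quat_add j (quat_scale (-1) (qconj J))) J.
  by apply: qmul_intertwine; rewrite ?tj ?nj.
move: it; set t := quat_add _ _ => it.
have [t0|t0] := pselect (t = quat_zero).
  exists I; split=> //; rewrite -[RHS]oppr0 -IJ -[J]qconjK (quat_sub_eq0 t0).
  by rewrite /qpolar /=; ring.
pose v := qnorm b a2 t.
have v0 : v != 0 by apply/eqP => /an.
exists (quat_scale v^-1 (qmul b a2 (qmul b a2 t I) (qconj t))); split.
- by rewrite qnormZ !qnormM qnorm_conj nI -/v; field.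
- rewrite qtraceZ qtrace_mul_conj qpolar_mull qmul_conj.
  rewrite [qpolar _ _ _ _](_ : _ = v * qtrace I); last first.
    by rewrite /qpolar /qtrace /= -/v; ring.
  by rewrite tI mulr1 mulVf.
- by rewrite qpolarC qpolarZr qpolarC (qpolar_conjl _ it) IJ !mulr0.
Qed.

End Slots.

(** * Linking the two forms *)

Section Linking.
Variables (F : fieldType) (two0 : (2 : F) = 0).

(* The form <1> + b[1, a] + b'[1, a'].                                         *)
Definition linkage_mx (R : comNzRingType) (b a b' a' : R) : 'M[R]_5 :=
  \matrix_(i, j) (nth [::] [:: [:: 1]; [:: 0; b; b]; [:: 0; 0; b * a];
     [:: 0; 0; 0; b'; b']; [:: 0; 0; 0; 0; b' * a']] i)`_j.

Definition vec5 (R : comNzRingType) (x y z u v : R) (i : 'I_5) :=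
  [:: x; y; z; u; v]`_i.

Lemma qform_linkage (R : comNzRingType) (b a b' a' x y z u v : R) :
  qform (linkage_mx b a b' a') (vec5 x y z u v) =
  x ^+ 2 + b * (y ^+ 2 + y * z + a * z ^+ 2)
  + b' * (u ^+ 2 + u * v + a' * v ^+ 2).
Proof.
rewrite /qform !big_ord_recl !big_ord0 !mxE /vec5 /=; ring.
Qed.

Lemma linkage_mx_map (R S : comNzRingType) (f : {rmorphism R -> S}) b a b' a' :
  map_mx f (linkage_mx b a b' a') = linkage_mx (f b) (f a) (f b') (f a').
Proof.
apply/matrixP => i j; rewrite !mxE.
case: i j => -[|[|[|[|[|//]]]]] ? [] [|[|[|[|[|//]]]]] ? /=;
  by rewrite ?rmorph0 ?rmorph1 ?rmorphM.
Qed.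

Definition linked_over (L : fieldType) (b a b' a' : L) (b1 a1 a2 : L) :=
  [/\ isometric (pfister_form b a) (pfister_form b1 a1),
      isometric (pfister_form b' a') (pfister_form b1 a2),
      qaniso2 b1 a1, qaniso2 b1 a2 & qaniso2 b1 (a1 + a2)].

(** An isotropic vector is a pair of trace-zero elements of equal norm in the two algebras;
    anisotropy makes both nonscalar, and their norm is the common slot. *)
Lemma isotropic_linkage (b a b' a' : F) :
  qaniso2 b a -> qaniso2 b' a' ->
  ~ isometric (pfister_form b a) (pfister_form b' a') ->
  ~ qaniso (linkage_mx b a b' a') ->
  exists b1 a1 a2, linked_over b a b' a' b1 a1 a2.
Proof.
move=> an an' nis /existsNP[v /not_implyP[qv nv]].
pose j : quat F := ((v ord0, 0), (v (inord 1), v (inord 2))).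
pose j' : quat F := ((0, 0), (v (inord 3), v (inord 4))).
have vE : v =1 vec5 j.1.1 j.2.1 j.2.2 j'.2.1 j'.2.2.
  by move=> i; rewrite /vec5 /=; case: i => -[|[|[|[|[|//]]]]] lt /=;
    congr v; apply: val_inj; rewrite /= ?inordK.
have njj' : qnorm b a j = qnorm b' a' j'.
  rewrite -[RHS]add0r -qv (eq_qform _ vE) qform_linkage /qnorm /=.
  by char2_ring two0.
have j'0 : j'.2 != (0, 0).
  apply/eqP => -[e3 e4]; case: nv.
  have /an[e0 e1 e2] : qnorm b a j = 0 by rewrite njj' /qnorm /= e3 e4; ring.
  by move=> i; rewrite vE /= /vec5 e0 e1 e2 e3 e4; case: i => -[|[|[|[|[|]]]]].
have nj'0 : qnorm b' a' j' <> 0.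
  by move=> /an' e; move: j'0; rewrite e eqxx.
have j0 : j.2 != (0, 0).
  apply/eqP => -[e1 e2]; case: nj'0.
  have /an'[e0 e3 e4] : qnorm b' a' ((v ord0, 0), j'.2) = 0.
    move: njj'; rewrite /qnorm /= e1 e2 => e.
    by rewrite -[RHS](subrr (v ord0 ^+ 2 + v ord0 * 0 + a * 0 ^+ 2 +
      b * (0 ^+ 2 + 0 * 0 + a * 0 ^+ 2))) {2}e; char2_ring two0.
  by rewrite /qnorm /= e3 e4; ring.
have tr0 (x y z : F) : qtrace ((x, 0), (y, z)) = 0 by rewrite qtrace_char2.
have [a1 i1] := qaniso2_scaled_slot two0 an (tr0 _ _ _) j0.
have [a2 i2] := qaniso2_scaled_slot two0 an' (tr0 _ _ _) j'0.
rewrite -njj' in i2; exists (qnorm b a j), a1, a2.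
have an1 := isometric_qaniso2 (isometric_sym i1) an.
split; [exact: isometric_sym | exact: isometric_sym | by [] | |].
  exact: isometric_qaniso2 (isometric_sym i2) an'.
apply: contrapT => /(isometric_common_slot two0 an1) i21; apply: nis.
apply: isometric_trans (isometric_sym i1) (isometric_sym _).
exact: isometric_trans (isometric_sym i2) i21.
Qed.

(* Over L = F(X)(u), u^2 = b' + b X^2, the slot b' can be changed into b.      *)
Lemma anisotropic_linkage (b a b' a' : F) :
  qaniso2 b a -> qaniso2 b' a' -> qaniso (linkage_mx b a b' a') ->
  exists (L : fieldType) (h : {rmorphism F -> L}) (b1 a1 a2 : L),
    linked_over (h b) (h a) (h b') (h a') b1 a1 a2.
Proof.
move=> an an' anl.
have b'0 := qaniso2_neq0 an'.
have ts : tot_sing_aniso b b'.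
  move=> x y z e; have := anl (vec5 x y 0 z 0).
  rewrite qform_linkage => /(_ _) V; split.
    by apply: (V _ (@Ordinal 5 1 isT)); rewrite -[RHS]e; ring.
  by apply: (V _ (@Ordinal 5 3 isT)); rewrite -[RHS]e; ring.
have [K [f [X fX]]] := rational_extP F.
have two0K := two0_map f two0.
have [L [h [u hu]]] := quadratic_pointP 0 (f b' + f b * X ^+ 2).
have two0L := two0_map h two0K.
have fth := faithful_insep two0 fX ts hu.
have fK := faithful_rational fX.
have X0 := rational_ext_neq0 fX.
have fb'0 : f b' != 0 by rewrite fmorph_eq0.
have hX0 : h X != 0 by rewrite fmorph_eq0.
have hb'0 : h (f b') != 0 by rewrite fmorph_eq0.
have [eu qu] := hu.
have {}eu : u ^+ 2 = h (f b') + h (f b) * h X ^+ 2.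
  rewrite -[RHS]add0r -eu rmorph0 !(rmorphD, rmorphM, rmorphXn).
  by char2_ring two0L.
pose a2 := f a' * f b * X ^+ 2 / f b'.
exists L, (h \o f), (h (f b)), (h (f a)), (h a2).
have i2 : isometric (pfister_form (h (f b')) (h (f a')))
                    (pfister_form (h (f b)) (h a2)).
  apply: isometric_sym.
  (* By u^2 = b' + b X^2, the element j below has norm (u^2 + b') / X^2 = b, and i, orthogonal to
     it, has norm a2. *)
  pose i : quat L := ((0, 1), (0, u / h (f b'))).
  pose j : quat L := ((u / h X, 0), ((h X)^-1, 0)).
  have ni : qnorm (h (f b')) (h (f a')) i = h a2.
    rewrite /qnorm /= [LHS](_ : _ = h (f a') * (h (f b') + u ^+ 2) / h (f b')).
      rewrite eu addrA [_ + h (f b')](_ : _ = 0) ?add0r; last by char2_ring two0L.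
      by rewrite /a2 !(rmorphM, rmorphXn, fmorphV) /= mulrA.
    by field.
  have nj : qnorm (h (f b')) (h (f a')) j = h (f b).
    rewrite /qnorm /= [LHS](_ : _ = (u ^+ 2 + h (f b')) / h X ^+ 2); last by field.
    rewrite eu [X in X / _](_ : _ = h (f b) * h X ^+ 2); last by char2_ring two0L.
    by field.
  rewrite -[X in pfister_form X (h a2)]nj -ni; apply: isometric_comb => //.
  - by rewrite qtrace_char2.
  - by rewrite qtrace_char2.
  - rewrite /qpolar /= [LHS](_ : _ = 2 * (u / h X)); first by rewrite two0L mul0r.
    by field; rewrite hX0 hb'0.
  - by rewrite nj fmorph_eq0 (qaniso2_neq0 (fK _ _ an)).
split; [exact: isometric_refl | by [] | exact: fth | |].
  by apply: isometric_qaniso2 i2 _; apply: fth.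
rewrite -rmorphD; apply: contrapT => nan.
pose e := f a + a2.
have [s ns ts0] : exists2 s, qnorm (f b) e s = f b' + f b * X ^+ 2 & qtrace s = 0.
  have [ane|nane] := pselect (qaniso2 (f b) e); first exact: qu ane nan.
  have [|l [w ew]] := isotropic_slot two0K _ nane.
    exact: (qaniso2_nonsquare two0K (fK _ _ an)).
  have fb0 := qaniso2_neq0 (fK _ _ an).
  (* For isotropic <<b, e]] the trace-zero elements take every value as norm: the one below has norm
     b (1 + t). *)
  pose t := (f b' + f b * X ^+ 2) / f b + 1.
  exists ((f b * w * t, 0), (1 + l * t, t)); last by rewrite qtrace_char2.
  rewrite -[RHS](_ : f b + f b * t = _); last first.
    rewrite /t mulrDr mulrCA mulfV // !mulr1; char2_ring two0K.
  by rewrite /qnorm /= ew; char2_ring two0K.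
move: ts0; rewrite qtrace_char2 //.
case: s ns => [[x ?] [z w]] /= ns s0; rewrite s0 in ns.
(* N(s) = b' + b X^2 rearranges to an isotropic vector (x, z + X, w, 1, y) of the linkage form,
   which stays anisotropic over F(X). *)
pose y := w * f b * X / f b'.
have q0 : qform (linkage_mx (f b) (f a) (f b') (f a'))
    (vec5 x (z + X) w 1 y) = 0.
  have bye : f b' * (1 ^+ 2 + 1 * y + f a' * y ^+ 2) =
      f b' + f b * X * w + f b * a2 * w ^+ 2.
    by rewrite /y /a2; field.
  rewrite qform_linkage bye.
  rewrite -[RHS](subrr (f b' + f b * X ^+ 2)) -{1}ns /qnorm /= /e.
  by char2_ring two0K.
have := rational_ext_qaniso fX anl; rewrite linkage_mx_map => /(_ _ q0).
by move=> /(_ (@Ordinal 5 3 isT))/eqP; rewrite oner_eq0.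
Qed.

Lemma linkage (b a b' a' : F) :
  qaniso2 b a -> qaniso2 b' a' ->
  ~ isometric (pfister_form b a) (pfister_form b' a') ->
  exists (L : fieldType) (h : {rmorphism F -> L}) (b1 a1 a2 : L),
    linked_over (h b) (h a) (h b') (h a') b1 a1 a2.
Proof.
move=> an an' nis.
have [anl|nanl] := pselect (qaniso (linkage_mx b a b' a')).
  exact: anisotropic_linkage.
have [b1 [a1 [a2 l]]] := isotropic_linkage an an' nis nanl.
by exists F, idfun, b1, a1, a2.
Qed.

End Linking.

(** * The extension field *)

Lemma two0_pchar (F : fieldType) : (2 : F) = 0 -> 2%N \in [pchar F].
Proof. by move=> two0; rewrite inE /= two0 eqxx. Qed.

(** For z outside E with z^2 = r + p z, separability forces p to be nonzero, and t = z / p. If c =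
    w^2 + w, then t would be w or w + 1, in E. *)
Lemma artin_schreier_generator (E : fieldType) (K : fieldExtType E) :
  (2 : E) = 0 -> \dim {:K} = 2%N -> separable 1%AS {:K} ->
  exists (c : E) (t : K), t ^+ 2 + t = in_alg K c /\ forall w, w ^+ 2 + w <> c.
Proof.
move=> two0 dimK sepK.
have two0K := two0_map (in_alg K) two0.
have [z nz1] : exists z : K, z \notin 1%VS.
  apply: contrapT => nz; have : (fullv <= (1 : {vspace K}))%VS.
    by apply/subvP => z _; apply: contrapT => /negP z1; apply: nz; exists z.
  by move/dimvS; rewrite dimK dimv1.
have inE1 (k : E) : in_alg K k \in 1%VS by apply/vlineP; exists k.
have bas : basis_of fullv [:: 1; z].
  rewrite basisEfree subvf dimK leqnn !andbT free_cons seq1_free span_seq1.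
  apply/andP; split; last by apply: contraNneq nz1 => ->; rewrite mem0v.
  apply/vlineP => -[k ek]; case/negP: nz1; have k0 : k != 0.
    by apply/eqP => k0; move/eqP: ek; rewrite k0 scale0r oner_eq0.
  by apply/vlineP; exists k^-1; rewrite ek scalerA mulVf // scale1r.
pose X : 2.-tuple K := [tuple 1; z].
have [r [p ez]] : exists r p : E, z ^+ 2 = in_alg K r + in_alg K p * z.
  have : z ^+ 2 \in <<X>>%VS by rewrite (span_basis bas) memvf.
  move=> /coord_span ->; rewrite !big_ord_recl big_ord0 addr0 /=.
  by eexists; eexists; rewrite mulr_algl.
have p0 : p != 0.
  apply: contraNneq nz1 => p0; move: ez; rewrite p0 rmorph0 mul0r addr0 => ez.
  have /separableP/(_ _ (memvf z)) : separable 1%AS {:K} by [].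
  have pK : 2%N \in [pchar K] by apply: two0_pchar.
  rewrite (pcharf_p_separable _ _ 0 pK) expn1 ez.
  by rewrite (Fadjoin_idP (inE1 r : _ \in (1%AS : {subfield K}))).
exists (r / p ^+ 2), (z / in_alg K p).
have hp0 : in_alg K p != 0 by rewrite fmorph_eq0.
split.
  rewrite !(rmorphM, fmorphV, rmorphXn) expr_div_n ez.
  set R := in_alg K r; set P := in_alg K p in hp0 *.
  rewrite [RHS](_ : _ = R / P ^+ 2 + 2 * (z / P)); last first.
    by rewrite two0K mul0r addr0.
  by field.
move=> w ew; set t := z / in_alg K p.
have : (t + in_alg K w) * (t + in_alg K w + 1) = 0.
  have et : t ^+ 2 = in_alg K (w ^+ 2 + w) + t.
    rewrite ew /t !(rmorphM, fmorphV, rmorphXn) expr_div_n ez.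
    by field.
  rewrite [LHS](_ : _ = t ^+ 2 + t + in_alg K (w ^+ 2 + w) + 2 * (t * in_alg K w)).
    by rewrite et two0K; char2_ring two0K.
  by rewrite rmorphD rmorphXn; ring.
have nt1 (k : E) : t + in_alg K k != 0.
  apply: contraNneq nz1 => /eqP; rewrite addr_eq0 -rmorphN => /eqP tk.
  have -> : z = in_alg K (- k * p) by rewrite rmorphM -tk /t divfK.
  exact: inE1.
apply/eqP; rewrite mulf_neq0 ?nt1 // -addrA -(rmorph1 (in_alg K)) -rmorphD.
exact: nt1.
Qed.

(** The equation gives an element i of trace 1 and norm c. Its second half, if nonzero, is
    orthogonal to it in characteristic 2 and serves as j. *)
Lemma isometric_norm_slot (E : fieldType) (b a c r s t : E) :
  (2 : E) = 0 -> qaniso2 b a ->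
  c + a + r ^+ 2 + r + b * (s ^+ 2 + s * t + a * t ^+ 2) = 0 ->
  exists2 e, e != 0 & isometric (pfister_form e c) (pfister_form b a).
Proof.
move=> two0 an e0.
pose i : quat E := ((r, 1), (s, t)).
have ni : qnorm b a i = c.
  by rewrite -[LHS]addr0 -e0 /qnorm /=; char2_ring two0.
pose j : quat E := if (s, t) == (0, 0) then ((0, 0), (1, 0)) else ((0, 0), (s, t)).
have j0 : qnorm b a j != 0.
  apply/eqP => /an; rewrite /j; case: eqP => [_ [/eqP]|nst [s0 t0]].
    by rewrite oner_eq0.
  by apply: nst; rewrite s0 t0.
exists (qnorm b a j) => //; rewrite -{1}ni; apply: isometric_comb => //.
- by rewrite qtrace_char2.
- by rewrite qtrace_char2 // /j; case: ifP.
- rewrite /j /i; case: eqP => [[-> ->]|_]; rewrite /qpolar /=;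
    char2_ring two0.
Qed.

Lemma hyperbolic_isometric (F : fieldType) (V W : vectType F) (q : V -> F)
    (r : W -> F) : isometric q r -> hyperbolic r -> hyperbolic q.
Proof. by move=> qr [m rm]; exists m; exact: isometric_trans qr rm. Qed.

Lemma universally_split (E : fieldType) (b a : E) (V : vectType E) (q : V -> E) :
  (2 : E) = 0 -> qaniso2 b a ->
  (forall x y z, exists s, solves b x y z s) ->
  isometric q (pfister_form b a) ->
  forall K : fieldExtType E, \dim {:K} = 2%N -> separable 1%AS {:K} ->
    hyperbolic (scalar_ext (in_alg K) q).
Proof.
move=> two0 an sol qi K dimK sepK.
have [c [t [tc nc]]] := artin_schreier_generator two0 dimK sepK.
have [s [_ /eqP]] := sol c a b; rewrite !mulf_eq0 (negPf (qaniso2_neq0 an)) /=.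
case/orP => [/eqP e|/eqP e].
  by case: (nc (s 2)); rewrite -[RHS]addr0 -e; char2_ring two0.
have [e1 e10 iso] := isometric_norm_slot two0 an e.
have hyp : hyperbolic (pfister_form (in_alg K e1) (in_alg K c)).
  rewrite -tc; apply: isometric_hyperbolic; first exact: two0_map (in_alg K) two0.
  by rewrite fmorph_eq0.
exact: hyperbolic_isometric
  (isometric_scalar_ext _ (isometric_trans qi (isometric_sym iso))) hyp.
Qed.

Lemma degree_over_squares (E : fieldType) (b : E) :
  (2 : E) = 0 -> (forall c, b <> c ^+ 2) ->
  (forall x, exists u v, x = u ^+ 2 + b * v ^+ 2) ->
  degree_over (@is_square E) 2.
Proof.
move=> two0 nsq sol; exists (fun i : 'I_2 => if i == ord0 then 1 else b) => x.
have sumE (c : {ffun 'I_2 -> E}) :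
    \sum_i c i * (if i == ord0 then 1 else b) = c ord0 + c ord_max * b.
  rewrite !big_ord_recl big_ord0 /= mulr1 addr0; congr (_ + c _ * b).
  exact: val_inj.
have [u [v xE]] := sol x.
exists [ffun i => if i == ord0 then u ^+ 2 else v ^+ 2]; split.
  split; last by rewrite sumE !ffunE /= xE; ring.
  by move=> i; rewrite ffunE; case: ifP => _; [exists u | exists v].
move=> c [csq]; rewrite sumE => xc.
have [p cp] := csq ord0; have [r cr] := csq ord_max.
have e : (u + p) ^+ 2 + b * (v + r) ^+ 2 = 0.
  rewrite -[RHS](subrr x) {1}xE xc cp cr; char2_ring two0.
have vr : v + r = 0.
  apply/eqP; apply: contraT => vr0; case: (nsq ((u + p) / (v + r))).
  rewrite expr_div_n; apply: (mulIf (expf_neq0 2 vr0)).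
  by rewrite divfK ?expf_neq0 // -[LHS]addr0 -e; char2_ring two0.
have up : u + p = 0.
  by move: e => /eqP; rewrite vr expr0n mulr0 addr0 expf_eq0 => /andP[_ /eqP].
have eqc2 (y z : E) : y + z = 0 -> y = z.
  by move=> yz; rewrite -[RHS]addr0 -yz; char2_ring two0.
apply/ffunP => i; rewrite ffunE; case: eqP => [->|/eqP i0].
  by rewrite cp (eqc2 _ _ up).
have -> : i = ord_max by apply: val_inj; case: i i0 => -[|[|//]] //= ? /eqP.
by rewrite cr (eqc2 _ _ vr).
Qed.

Theorem theorem6p5 (F : fieldType) (charF : 2%N \in [pchar F])
    (V V' : vectType F) (q : V -> F) (q' : V' -> F)
    (pf : pfister2 q) (pf' : pfister2 q')
    (an : anisotropic q) (an' : anisotropic q')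
    (nis : ~ isometric q q') :
  exists (E : fieldType) (f : {rmorphism F -> E}),
    [/\ degree_over (@is_square E) 2,
        anisotropic (scalar_ext f q),
        anisotropic (scalar_ext f q'),
        totally_separably_linked (scalar_ext f q) (scalar_ext f q') &
        ~ isometric (scalar_ext f q) (scalar_ext f q')].
Proof.
have two0 : (2 : F) = 0 by exact: pcharf0 charF.
have [_ [a [b [_ qi]]]] := pf; have [_ [a' [b' [_ qi']]]] := pf'.
have ab : qaniso2 b a by apply/qaniso2P; exact: isometric_anisotropic qi an.
have ab' : qaniso2 b' a' by apply/qaniso2P; exact: isometric_anisotropic qi' an'.
have nis2 : ~ isometric (pfister_form b a) (pfister_form b' a').
  by move=> i; apply: nis; exact: isometric_trans (isometric_trans qi i) (isometric_sym qi').
have [L [h [b1 [a1 [a2 [i1 i2 n1 n2 n12]]]]]] := linkage two0 ab ab' nis2.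
have two0L := two0_map h two0.
have [E [g [fg sol]]] := solvable_closure two0L n1.
have two0E := two0_map g two0L.
(* An isometry over L extends to E; both sides are compared with the scalar extension along g. *)
have lift (x y : F) (q1 q2 : L) : isometric (pfister_form (h x) (h y))
    (pfister_form q1 q2) -> isometric (pfister_form (g (h x)) (g (h y)))
    (pfister_form (g q1) (g q2)).
  move=> i; apply: isometric_trans (isometric_scalar_ext g i).
  exact/isometric_sym/isometric_scalar_ext/isometric_refl.
pose f : {rmorphism F -> E} := g \o h.
have j1 : isometric (scalar_ext f q) (pfister_form (g b1) (g a1)).
  exact: isometric_trans (isometric_scalar_ext f qi) (lift _ _ _ _ i1).
have j2 : isometric (scalar_ext f q') (pfister_form (g b1) (g a2)).
  exact: isometric_trans (isometric_scalar_ext f qi') (lift _ _ _ _ i2).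
have m1 := fg _ _ n1; have m2 := fg _ _ n2.
exists E, f; split.
- apply: (degree_over_squares two0E (qaniso2_nonsquare two0E m1)) => x.
  by have [s [e _]] := sol x 0 0; exists (s 0), (s 1).
- by apply: isometric_anisotropic (isometric_sym j1) _; apply/qaniso2P.
- by apply: isometric_anisotropic (isometric_sym j2) _; apply/qaniso2P.
- move=> K dimK sepK; split=> _.
    exact: universally_split two0E m2 sol j2 K dimK sepK.
  exact: universally_split two0E m1 sol j1 K dimK sepK.
- move=> i; have i12 := isometric_trans (isometric_sym j1) (isometric_trans i j2).
  apply: (isometric_isotropic_sum two0E m2 i12).
  by rewrite -rmorphD; exact: fg.
Qed.
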